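(* Let $G$ be a countable discrete group. The natural map $\mathrm{Sub}_{\rm sg}(G)\to\mathrm{Prim}(G)$, $H\mapsto[\lambda_{G/H}]$, factorizes to an injective map from the quotient space $\mathrm{Sub}_{\rm sg}(G)/G$ of $G$-conjugacy classes to $\mathrm{Prim}(G)$, where $[\lambda_{G/H}]$ denotes the weak equivalence class of $\lambda_{G/H}$.
   Context: $\lambda_{G/H}$ denotes the quasi-regular representation of $G$ on $\ell^2(G/H)$. Every unitary representation of a group $\Gamma$ is extended to the maximal $C^*$-algebra $C^*(\Gamma)$; $\rho$ is weakly contained in $\pi$, written $\rho\prec\pi$, if $\|\rho(x)\|\le\|\pi(x)\|$ for all $x\in C^*(\Gamma)$; $\rho$ and $\pi$ are weakly equivalent if $\rho\prec\pi$ and $\pi\prec\rho$. $\mathrm{Prim}(G)$ is the set of weak equivalence classes of irreducible unitary representations of $G$. An action of a group $\Gamma$ on a set $X$ has a spectral gap if the associated natural unitary representation of $\Gamma$ on $\ell^2(X)$ does not weakly contain the trivial representation $1_\Gamma$. A subgroup $H$ of $G$ has the spectral gap property if the action by left translation of $H$ on $X=G/H\setminus\{H\}$ has a spectral gap. $\mathrm{Sub}_{\rm sg}(G)$ is the set of all such subgroups; $G$ acts on it by conjugation. (For $H\in\mathrm{Sub}_{\rm sg}(G)$ the representation $\lambda_{G/H}$ is irreducible, so it defines a point of $\mathrm{Prim}(G)$.) *)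

(* Defs.v *)
From HB Require Import structures.
From mathcomp Require Import all_boot all_order all_algebra.
From mathcomp Require Import sesquilinear finmap complex ring lra.
From mathcomp Require Import all_classical reals ereal topology normedtype.
From mathcomp Require Import sequences esum.

Set Implicit Arguments.
Unset Strict Implicit.
Unset Printing Implicit Defensive.

Import Order.TTheory GRing.Theory Num.Theory.
Import numFieldNormedType.Exports.

Local Open Scope classical_set_scope.
Local Open Scope ring_scope.

(* A complex Hilbert space: a Banach space whose norm comes from an inner
   product, linear in its first argument. *)
Record hilbert (R : realType) := Hilbert {
  hspace :> completeNormedModType R[i];
  hdot : {dot hspace for Num.conj};
  hnormE : forall x, `|x| ^+ 2 = hdot x x }.

Section FormNorm.
Variables (C : numClosedFieldType) (V : lmodType C) (form : {dot V for Num.conj}).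
Local Notation "''[' u , v ]" := (form u v).

Lemma form_CS (u v : V) : `|'[u, v]| ^+ 2 <= '[u, u] * '[v, v].
Proof.
have [->|v0] := eqVneq v 0.
  by rewrite !linear0r normr0 expr0n mulr0.
have vv : 0 < '[v, v] by rewrite neq0_dnorm_gt0.
pose a := '[u, v] / '[v, v].
have := dnorm_ge0 form (u - a *: v).
rewrite linearBl/= linearBr/= linearBr/= !linearZl_LR/= !linearZr_LR/=.
have -> : '[v, u] = ('[u, v])^* by rewrite (hermC form v u) /= expr0 mul1r.
rewrite /a rmorphM fmorphV/= [X in _ / X](_ : _ = '[v, v]); last first.
  by apply: CrealP; rewrite ger0_real ?ltW.
have vn : '[v, v] != 0 by rewrite gt_eqF.
set d := '[u, v]; set w := '[v, v] in vv vn *; set z := '[u, u].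
set e := (form u v)^* .
rewrite [X in _ <= X](_ : _ = z - d * e / w); last by field.
by rewrite subr_ge0 ler_pdivrMr// normCK.
Qed.

Definition form_norm (u : V) : C := sqrtC '[u, u].

Lemma form_normD u v : form_norm (u + v) <= form_norm u + form_norm v.
Proof.
rewrite -(@ler_pXn2r _ 2%N)// ?nnegrE ?addr_ge0 ?sqrtC_ge0 ?dnorm_ge0//.
rewrite /form_norm sqrtCK sqrrD !sqrtCK dnormD/= [leRHS]addrAC lerD2l.
have CS : `|'[u, v]| <= sqrtC '[u, u] * sqrtC '[v, v].
  rewrite -(@ler_pXn2r _ 2%N)// ?nnegrE ?mulr_ge0 ?sqrtC_ge0 ?dnorm_ge0//.
  by rewrite exprMn !sqrtCK form_CS.
apply: (@le_trans _ _ (`|'[u, v]| *+ 2)); last by rewrite lerMn2r CS.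
have Rd : '[u, v] + ('[u, v])^* \is Num.real.
  by apply/CrealP; rewrite rmorphD /= conjCK addrC.
apply: (le_trans (real_ler_norm Rd)); apply: (le_trans (ler_normD _ _)).
by rewrite norm_conjC mulr2n.
Qed.

Lemma form_normZ c u : form_norm (c *: u) = `|c| * form_norm u.
Proof.
by rewrite /form_norm dnormZ sqrtCM ?nnegrE ?exprn_ge0 ?dnorm_ge0// sqrCK.
Qed.

Lemma form_norm0_eq0 u : form_norm u = 0 -> u = 0.
Proof. by move/eqP; rewrite sqrtC_eq0 dnorm_eq0 => /eqP. Qed.

End FormNorm.

Section Sums.
Variables (R : realType) (X : choiceType).
Implicit Types p q f g : X -> R.

(* Unordered sums over [X]: [nnsum] of nonnegative families, [rsum] of absolutely
   summable real families (positive part minus negative part), and [csum] of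
   complex families. *)
Definition nnsum p : \bar R := \esum_(x in [set: X]) (p x)%:E.

Definition rsum f : R :=
  fine (nnsum (fun x => Num.max (f x) 0)) -
  fine (nnsum (fun x => Num.max (- f x) 0)).

Definition abs_summable f := (nnsum (fun x => `|f x|%R) < +oo)%E.

Let nn p := forall x, 0 <= p x.

Lemma nnsum_ge0 p : nn p -> (0 <= nnsum p)%E.
Proof. by move=> p0; apply: esum_ge0 => x _; rewrite lee_fin. Qed.

Lemma nnsum_le p q : (forall x, p x <= q x) -> (nnsum p <= nnsum q)%E.
Proof. by move=> pq; apply: le_esum => x _; rewrite lee_fin. Qed.

Lemma nnsumD p q : nn p -> nn q ->
  nnsum (fun x => p x + q x) = (nnsum p + nnsum q)%E.
Proof.
by move=> p0 q0; rewrite /nnsum -esumD// => x _; rewrite ?lee_fin.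
Qed.

Lemma nnsum_fin p : nn p -> (nnsum p < +oo)%E -> nnsum p \is a fin_num.
Proof. by move=> p0 pfin; rewrite ge0_fin_numE// nnsum_ge0. Qed.

Lemma nnsumZ_le c p : 0 <= c -> nn p ->
  (nnsum (fun x => (c * p x)%R) <= c%:E * nnsum p)%E.
Proof.
move=> c0 p0; apply: ge_ereal_sup => _ [A [finA AX] <-].
rewrite (eq_fsbigr (fun x => (c%:E * (p x)%:E)%E)); last by move=> x _; rewrite EFinM.
rewrite -ge0_mule_fsumr; last by move=> x; rewrite lee_fin.
rewrite lee_wpmul2l ?lee_fin//; apply: ereal_sup_ubound.
by exists A.
Qed.

Lemma nnsumZ c p : 0 <= c -> nn p ->
  nnsum (fun x => c * p x) = (c%:E * nnsum p)%E.
Proof.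
rewrite le_eqVlt => /predU1P[<- p0|c0 p0].
  rewrite mul0e [LHS]esum1// => x _; by rewrite mul0r.
have cp0 : nn (fun x => c * p x) by move=> x; rewrite mulr_ge0// ltW.
apply/le_anti/andP; split; first by rewrite nnsumZ_le ?ltW.
rewrite -lee_pdivlMl//.
rewrite [in leLHS](_ : p = fun x => c^-1 * (c * p x)).
  by rewrite nnsumZ_le// invr_ge0 ltW.
by apply/funext => x; rewrite mulKf// gt_eqF.
Qed.

Lemma nnsum_le_lt p q : (forall x, p x <= q x) -> (nnsum q < +oo)%E ->
  (nnsum p < +oo)%E.
Proof. by move=> pq; apply: le_lt_trans; exact: nnsum_le. Qed.

Lemma rsum_diff p q : nn p -> nn q -> (nnsum p < +oo)%E -> (nnsum q < +oo)%E ->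
  rsum (fun x => p x - q x) = fine (nnsum p) - fine (nnsum q).
Proof.
move=> p0 q0 pfin qfin; rewrite /rsum.
set P := fun x => Num.max (p x - q x) 0.
set Q := fun x => Num.max (- (p x - q x)) 0.
have P0 : nn P by move=> x; rewrite le_max lexx orbT.
have Q0 : nn Q by move=> x; rewrite le_max lexx orbT.
have Pfin : (nnsum P < +oo)%E.
  apply: nnsum_le_lt pfin => x; rewrite ge_max p0 andbT lerBlDr lerDl; exact: q0.
have Qfin : (nnsum Q < +oo)%E.
  apply: nnsum_le_lt qfin => x; rewrite ge_max q0 andbT opprB lerBlDr lerDl; exact: p0.
have : (nnsum P + nnsum q = nnsum Q + nnsum p)%E.
  rewrite -!nnsumD//; congr nnsum; apply/funext => x.
  by rewrite /P /Q; case: (leP (p x - q x) 0); case: (leP (- (p x - q x)) 0); lra.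
move: (nnsum_fin p0 pfin) (nnsum_fin q0 qfin) (nnsum_fin P0 Pfin) (nnsum_fin Q0 Qfin).
move=> /fineK<- /fineK<- /fineK<- /fineK<-.
by rewrite -!EFinD/= => -[]; lra.
Qed.

Let pos f x := Num.max (f x) 0.
Let neg f x := Num.max (- f x) 0.

Let pos_ge0 f : nn (pos f). Proof. by move=> x; rewrite le_max lexx orbT. Qed.
Let neg_ge0 f : nn (neg f). Proof. by move=> x; rewrite le_max lexx orbT. Qed.

Let posneg f x : f x = pos f x - neg f x.
Proof. by rewrite /pos /neg; case: (leP (f x) 0); case: (leP (- f x) 0); lra. Qed.

Let pos_fin f : abs_summable f -> (nnsum (pos f) < +oo)%E.
Proof.
by apply: nnsum_le_lt => x; rewrite ge_max normr_ge0 ler_norm.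
Qed.

Let neg_fin f : abs_summable f -> (nnsum (neg f) < +oo)%E.
Proof.
by apply: nnsum_le_lt => x; rewrite ge_max normr_ge0 -normrN ler_norm.
Qed.

Lemma rsumD f g : abs_summable f -> abs_summable g ->
  rsum (fun x => f x + g x) = rsum f + rsum g.
Proof.
move=> Sf Sg.
have [pf nf pg ng] := And4 (pos_fin Sf) (neg_fin Sf) (pos_fin Sg) (neg_fin Sg).
rewrite (_ : (fun x => _) =
    fun x => (pos f x + pos g x) - (neg f x + neg g x)); last first.
  by apply/funext => x; rewrite {1}(posneg f) {1}(posneg g); lra.
rewrite rsum_diff ?nnsumD ?lte_add_pinfty//; last 2 first.
- by move=> x; rewrite addr_ge0// ?pos_ge0.
- by move=> x; rewrite addr_ge0// ?neg_ge0.
rewrite !fineD ?nnsum_fin// /rsum -/(pos f) -/(neg f) -/(pos g) -/(neg g).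
rewrite -!/(pos _) -!/(neg _); lra.
Qed.

Lemma rsumN f : rsum (fun x => - f x) = - rsum f.
Proof.
rewrite /rsum opprB; congr (_ - fine (nnsum _)).
by apply/funext => x; rewrite opprK.
Qed.

Lemma rsumZ c f : rsum (fun x => c * f x) = c * rsum f.
Proof.
wlog c0 : c f / 0 <= c => [hw|].
  have [/hw->//|c0] := leP 0 c.
  rewrite (_ : (fun x => _) = fun x => (- c) * - f x); last first.
    by apply/funext => x; rewrite mulrNN.
  by rewrite hw ?oppr_ge0 ?ltW// rsumN mulrNN.
have mx f' x : Num.max (c * f' x) 0 = c * Num.max (f' x) 0.
  by rewrite maxr_pMr// mulr0.
have E f' : fine (nnsum (fun x => Num.max (c * f' x) 0)) =
            c * fine (nnsum (fun x => Num.max (f' x) 0)).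
  have -> : (fun x => Num.max (c * f' x) 0) = (fun x => c * Num.max (f' x) 0).
    by apply/funext => x; exact: mx.
  rewrite nnsumZ//; last exact: (pos_ge0 f').
  have := nnsum_ge0 (pos_ge0 f').
  rewrite /pos; case: nnsum => [r| |]//= _.
  move: c0; rewrite le_eqVlt => /predU1P[<-|c0]; first by rewrite mul0e mul0r.
  by rewrite gt0_muley ?lte_fin//= mulr0.
rewrite /rsum E mulrBr -(E (fun x => - f x)); congr (_ - fine (nnsum _)).
by apply/funext => x; rewrite mulrN.
Qed.

Lemma rsum_nn p : nn p -> rsum p = fine (nnsum p).
Proof.
move=> p0; rewrite /rsum.
have -> : (fun x => Num.max (p x) 0) = p by apply/funext => x; apply/max_idPl.
have -> : (fun x => Num.max (- p x) 0) = fun=> 0.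
  by apply/funext => x; apply/max_idPr; rewrite oppr_le0.
by rewrite [X in _ - fine X]esum1// subr0.
Qed.

Lemma abs_summableD f g : abs_summable f -> abs_summable g ->
  abs_summable (fun x => f x + g x).
Proof.
move=> Sf Sg; apply: (@nnsum_le_lt _ (fun x => `|f x| + `|g x|)).
  by move=> x; exact: ler_normD.
by rewrite nnsumD// lte_add_pinfty.
Qed.

Lemma abs_summableZ c f : abs_summable f -> abs_summable (fun x => c * f x).
Proof.
move=> Sf; rewrite /abs_summable.
have -> : (fun x => `|c * f x|) = (fun x => `|c| * `|f x|).
  by apply/funext => x; rewrite normrM.
by rewrite nnsumZ// lte_mul_pinfty// lee_fin.
Qed.

End Sums.

Section ComplexSums.
Variables (R : realType) (X : choiceType).
Local Notation C := R[i].
Implicit Types (f g : X -> C) (z w : C).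

Definition csum f : C :=
  Complex (rsum (fun x => complex.Re (f x))) (rsum (fun x => complex.Im (f x))).

(* |z|^2 as an element of [R]. *)
Definition sqmod z : R := complex.Re (`|z| ^+ 2).

Lemma sqmodE z : sqmod z = complex.Re z ^+ 2 + complex.Im z ^+ 2.
Proof. by rewrite /sqmod -add_Re2_Im2. Qed.

Lemma sqmod_norm z : (sqmod z)%:C%C = `|z| ^+ 2.
Proof. by rewrite sqmodE add_Re2_Im2. Qed.

Lemma sqmod_ge0 z : 0 <= sqmod z.
Proof. by rewrite sqmodE addr_ge0// sqr_ge0. Qed.

Lemma sqmodD z w : sqmod (z + w) <= 2 * sqmod z + 2 * sqmod w.
Proof.
rewrite !sqmodE; case: z w => [a b] [c d]/=.
rewrite -subr_ge0 (_ : _ - _ = (a - c) ^+ 2 + (b - d) ^+ 2); last by ring.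
by rewrite addr_ge0 ?sqr_ge0.
Qed.

Lemma sqmodM z w : sqmod (z * w) = sqmod z * sqmod w.
Proof. by rewrite !sqmodE; case: z w => [a b] [c d]/=; ring. Qed.

Lemma sqmodN z : sqmod (- z) = sqmod z.
Proof. by rewrite /sqmod normrN. Qed.

Lemma mulCJE z w : z * w^* =
  Complex (complex.Re z * complex.Re w + complex.Im z * complex.Im w)
          (complex.Im z * complex.Re w - complex.Re z * complex.Im w).
Proof.
case: z w => [a b] [c d]; rewrite [LHS]/(_ * _)/=.
by congr Complex; ring.
Qed.

Definition csummable f :=
  abs_summable (fun x => complex.Re (f x)) /\
  abs_summable (fun x => complex.Im (f x)).

Lemma csumD f g : csummable f -> csummable g ->
  csum (fun x => f x + g x) = csum f + csum g.
Proof.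
move=> [rf jf] [rg jg]; rewrite /csum.
rewrite [RHS]/(_ + _)/= -rsumD// -rsumD//.
by congr Complex; congr rsum; apply/funext => x; case: (f x) (g x) => [? ?] [].
Qed.

Lemma csummableZ c f : csummable f -> csummable (fun x => c * f x).
Proof.
case: c => a b [rf jf]; split.
- rewrite (_ : (fun x => _) = fun x =>
      a * complex.Re (f x) + (- b) * complex.Im (f x)).
    by apply: abs_summableD; exact: abs_summableZ.
  by apply/funext => x; case: (f x) => [u v] /=; rewrite mulNr.
- rewrite (_ : (fun x => _) = fun x =>
      a * complex.Im (f x) + b * complex.Re (f x)).
    by apply: abs_summableD; exact: abs_summableZ.
  by apply/funext => x; case: (f x) => [u v].
Qed.

Lemma csumZ c f : csummable f -> csum (fun x => c * f x) = c * csum f.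
Proof.
case: c => a b [rf jf]; rewrite /csum.
rewrite [RHS]/(_ * _)/=.
rewrite -!rsumZ -rsumN -!rsumD//; try exact: abs_summableZ; last first.
  have -> : (fun x => - (b * complex.Im (f x))) =
            (fun x => (- b) * complex.Im (f x)).
    by apply/funext => x; rewrite mulNr.
  exact: abs_summableZ.
by congr Complex; congr rsum; apply/funext => x; case: (f x) => [? ?].
Qed.

Lemma csumJ f : csum (fun x => (f x)^*)%R = (csum f)^*.
Proof.
rewrite /csum [RHS]/(Num.conj _)/= -rsumN.
by congr Complex; congr rsum; apply/funext => x; case: (f x) => [? ?].
Qed.

Definition sq_summable f := (nnsum (fun x => sqmod (f x)) < +oo)%E.

Lemma sq_summableD f g : sq_summable f -> sq_summable g -> sq_summable (f + g).
Proof.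
move=> Sf Sg.
apply: (@nnsum_le_lt _ _ _ (fun x => 2 * sqmod (f x) + 2 * sqmod (g x))).
  by move=> x; exact: sqmodD.
have s0 h x : 0 <= sqmod (h x) :> R := sqmod_ge0 (h x).
rewrite nnsumD//; last 2 first.
- by move=> x; rewrite mulr_ge0.
- by move=> x; rewrite mulr_ge0.
by rewrite !nnsumZ// lte_add_pinfty// lte_mul_pinfty// lee_fin.
Qed.

Lemma sq_summableZ c f : sq_summable f -> sq_summable (c *: f).
Proof.
move=> Sf; rewrite /sq_summable.
have -> : (fun x => sqmod ((c *: f) x)) = (fun x => sqmod c * sqmod (f x)).
  by apply/funext => x; exact: sqmodM.
rewrite nnsumZ ?sqmod_ge0//; last by move=> x; exact: sqmod_ge0.
by rewrite lte_mul_pinfty// lee_fin sqmod_ge0.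
Qed.

Lemma sq_summable0 : sq_summable 0.
Proof.
rewrite /sq_summable /nnsum esum1 ?ltry// => x _.
by rewrite /sqmod normr0 expr0n.
Qed.

Lemma sq_summable_prod f g : sq_summable f -> sq_summable g ->
  csummable (fun x => f x * (g x)^*).
Proof.
move=> Sf Sg.
have H : (nnsum (fun x => (sqmod (f x) + sqmod (g x))%R) < +oo)%E.
  by rewrite nnsumD ?lte_add_pinfty// => x; exact: sqmod_ge0.
have sq (a b c d : R) : `|a * c + b * d| <= a ^+ 2 + b ^+ 2 + (c ^+ 2 + d ^+ 2).
  have h u v : u * v <= (u ^+ 2 + v ^+ 2) / 2 :> R.
    by have := sqr_ge0 (u - v); rewrite sqrrB; lra.
  have := (h a c); have := (h b d); have := h (- a) c; have := h (- b) d.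
  have := sqr_ge0 a; have := sqr_ge0 b; have := sqr_ge0 c; have := sqr_ge0 d.
  by rewrite !sqrrN !mulNr ler_norml; lra.
split; apply: (nnsum_le_lt _ H) => x; rewrite !sqmodE mulCJE /= ?sq//.
have := sq (complex.Im (f x)) (- complex.Re (f x)) (complex.Re (g x)) (complex.Im (g x)).
by rewrite mulNr sqrrN [_ ^+ 2 + complex.Re (f x) ^+ 2]addrC.
Qed.

End ComplexSums.

Section Ell2.
Variables (R : realType) (X : choiceType).
Local Notation C := R[i].

Definition ell2_pred : {pred X -> C} := fun f => `[< sq_summable f >].

Lemma ell2_submod_closed : submod_closed ell2_pred.
Proof.
split; first by apply/asboolP; exact: sq_summable0.
move=> c f g /asboolP Sf /asboolP Sg; apply/asboolP.
by apply: sq_summableD => //; exact: sq_summableZ.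
Qed.

HB.instance Definition _ :=
  GRing.isSubmodClosed.Build C (X -> C) ell2_pred ell2_submod_closed.

Record ell2 := Ell2 { ell2_fun :> X -> C ; _ : ell2_fun \in ell2_pred }.

HB.instance Definition _ := [isSub for ell2_fun].
HB.instance Definition _ := [Choice of ell2 by <:].
HB.instance Definition _ := [SubChoice_isSubLmodule of ell2 by <:].

Lemma ell2P (f : ell2) : sq_summable f.
Proof. by apply/asboolP; exact: valP f. Qed.

Definition ell2_dot (f g : ell2) : C := csum (fun x => f x * (g x)^*).

Lemma ell2_dot_bilinear : bilinear_for *%R (Num.conj \; *%R) ell2_dot.
Proof.
have S (f g : ell2) := sq_summable_prod (ell2P f) (ell2P g).
split=> [g c f1 f2|f c g1 g2] /=.
  rewrite /ell2_dot -csumZ// -csumD//; last exact/csummableZ/S.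
  by congr csum; apply/funext => x; rewrite mulrDl mulrA.
rewrite /ell2_dot -csumZ// -csumD//; last exact/csummableZ/S.
by congr csum; apply/funext => x; rewrite rmorphD rmorphM /= mulrDr mulrCA.
Qed.

HB.instance Definition _ := @bilinear_isBilinear.Build
  C ell2 ell2 C *%R (Num.conj \; *%R) ell2_dot ell2_dot_bilinear.

Lemma ell2_dot_hermitian (f g : ell2) :
  ell2_dot f g = (-1) ^+ false * (ell2_dot g f)^*.
Proof.
rewrite expr0 mul1r /ell2_dot -csumJ; congr csum; apply/funext => x.
by rewrite rmorphM /= conjCK mulrC.
Qed.

HB.instance Definition _ := isHermitianSesquilinear.Build
  C ell2 false Num.conj ell2_dot ell2_dot_hermitian.

Lemma ell2_dotE (f : ell2) :
  ell2_dot f f = (fine (nnsum (fun x => sqmod (f x))))%:C%C.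
Proof.
rewrite /ell2_dot /csum -rsum_nn; last by move=> x; exact: sqmod_ge0.
have -> : (fun x => complex.Re (f x * (f x)^*)) = (fun x => sqmod (f x)).
  by apply/funext => x; rewrite /sqmod normCK.
rewrite (_ : (fun x => complex.Im _) = fun x => 0 * 0); last first.
  by apply/funext => x; rewrite mulCJE/= mulrC subrr mulr0.
by rewrite rsumZ mul0r.
Qed.

Lemma ell2_dot_gt0 (f : ell2) : f != 0 -> 0 < ell2_dot f f.
Proof.
move=> f0; rewrite ell2_dotE ltcR lt_neqAle fine_ge0 ?andbT; last first.
  by apply: nnsum_ge0 => x; exact: sqmod_ge0.
apply: contra f0 => /eqP/esym s0; apply/eqP/val_inj/funext => x /=.
have : ((sqmod (f x))%:E <= nnsum (fun x => sqmod (f x)))%E.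
  apply: ereal_sup_ubound; exists [set x]; last by rewrite fsbig_set1.
  by split=> //; exact: finite_set1.
rewrite -[nnsum _]fineK; last first.
  by apply: nnsum_fin (ell2P f) => y; exact: sqmod_ge0.
rewrite s0 lee_fin => fx0.
have : `|f x| ^+ 2 = 0.
  rewrite -sqmod_norm; have -> // : sqmod (f x) = 0.
  by apply/le_anti; rewrite fx0 sqmod_ge0.
by move/eqP; rewrite sqrf_eq0 normr_eq0 => /eqP.
Qed.

HB.instance Definition _ := isDotProduct.Build C ell2 ell2_dot ell2_dot_gt0.

HB.instance Definition _ := Lmodule_isNormed.Build C ell2
  (form_normD ell2_dot) (form_normZ ell2_dot) (form_norm0_eq0 (form := ell2_dot)).

Lemma ell2_normE (f : ell2) : `|f| ^+ 2 = ell2_dot f f.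
Proof. by rewrite [Num.norm f]/(form_norm ell2_dot f) /form_norm sqrtCK. Qed.

End Ell2.

Section Completeness.
Variable R : realType.
Local Notation C := R[i].

Lemma gt0_complexE (e : C) : 0 < e -> exists2 r : R, 0 < r & e = r%:C%C.
Proof.
case: e => a b; rewrite ltcE /= => /andP[/eqP -> a0].
by exists a.
Qed.

Lemma ReD (z w : C) : complex.Re (z - w) = complex.Re z - complex.Re w.
Proof. by case: z w => [? ?] []. Qed.

Lemma ImD (z w : C) : complex.Im (z - w) = complex.Im z - complex.Im w.
Proof. by case: z w => [? ?] []. Qed.

Lemma sqmod_lt (z : C) (e : R) : 0 < e -> (`|z| < e%:C%C) = (sqmod z < e ^+ 2).
Proof.
move=> e0; rewrite -(@ltr_pXn2r _ 2%N)// ?nnegrE ?normr_ge0 ?ler0c ?(ltW e0)//.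
by rewrite -sqmod_norm -rmorphXn/= ltcR.
Qed.

Lemma Re_sqmod (z : C) (e : R) : 0 < e -> sqmod z < e ^+ 2 -> `|complex.Re z| < e.
Proof.
move=> e0 ze; rewrite -(@ltr_pXn2r _ 2%N)// ?nnegrE ?(ltW e0)// real_normK ?num_real//.
by apply: le_lt_trans ze; rewrite sqmodE lerDl sqr_ge0.
Qed.

Lemma Im_sqmod (z : C) (e : R) : 0 < e -> sqmod z < e ^+ 2 -> `|complex.Im z| < e.
Proof.
move=> e0 ze; rewrite -(@ltr_pXn2r _ 2%N)// ?nnegrE ?(ltW e0)// real_normK ?num_real//.
by apply: le_lt_trans ze; rewrite sqmodE lerDr sqr_ge0.
Qed.

Lemma cauchy_coord (T : Type) (F : set_system T) (u : T -> R) :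
  ProperFilter F ->
  (forall e, 0 < e -> exists t, F [set s | `|u t - u s| < e]) ->
  exists l : R, u @ F --> l.
Proof.
move=> FF h; suff /cvg_ex[l ul] : cvg (u @ F) by exists l.
apply: R_complete; apply/cauchyP => e e0.
have [t Ft] := h e e0; exists (u t).
by rewrite -ball_normE.
Qed.

Lemma complex_complete (F : set_system C^o) :
  ProperFilter F -> cauchy F -> cvg F.
Proof.
move=> FF /cauchyP Fc.
have Fball (e : R) : 0 < e -> exists z : C, F [set w : C | sqmod (z - w) < e ^+ 2].
  move=> e0; have [|z Fz] := Fc (e%:C)%C; first by rewrite (ltcR 0).
  exists z; apply: filterS Fz => w.
  by rewrite -ball_normE /= sqmod_lt.
have [a Fa] : exists l : R, (fun z : C^o => complex.Re z) @ F --> l.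
  apply: cauchy_coord => e e0; have [z Fz] := Fball e e0.
  by exists z; apply: filterS Fz => w /= /(Re_sqmod e0); rewrite ReD.
have [b Fb] : exists l : R, (fun z : C^o => complex.Im z) @ F --> l.
  apply: cauchy_coord => e e0; have [z Fz] := Fball e e0.
  by exists z; apply: filterS Fz => w /= /(Im_sqmod e0); rewrite ImD.
apply/cvg_ex; exists (Complex a b : C^o); apply/cvgrPdist_lt => e /gt0_complexE[r r0 ->].
have r2 : 0 < r / 2 by rewrite divr_gt0.
near=> w; rewrite /= sqmod_lt// sqmodE ReD ImD /=.
have wa : `|a - complex.Re w| < r / 2.
  by near: w; move/cvgrPdist_lt : Fa; exact.
have wb : `|b - complex.Im w| < r / 2.
  by near: w; move/cvgrPdist_lt : Fb; exact.
move: wa wb; rewrite !ltr_norml => /andP[? ?] /andP[? ?].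
nra.
Unshelve. all: by end_near. Qed.

End Completeness.

(* The complex plane as a Banach space. An alias is needed because the instances
   on [R[i]^o] would collide with the library ones on [R^o] for [R : realType]. *)
Definition cplane (R : realType) : Type := R[i].

HB.instance Definition _ (R : realType) := NormedModule.copy (cplane R) (R[i])^o.
HB.instance Definition _ (R : realType) :=
  Uniform_isComplete.Build (cplane R) (@complex_complete R).

Section Ell2Complete.
Variables (R : realType) (X : choiceType).
Local Notation C := R[i].

Lemma ell2_sqmod_norm (f : ell2 R X) :
  `|f| ^+ 2 = (fine (nnsum (fun x => sqmod (f x))))%:C%C.
Proof. by rewrite ell2_normE ell2_dotE. Qed.

Lemma ell2_norm_lt (f : ell2 R X) (e : R) : 0 < e ->
  (`|f| < e%:C%C) = (nnsum (fun x => sqmod (f x)) < (e ^+ 2)%:E)%E.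
Proof.
move=> e0; rewrite -(@ltr_pXn2r _ 2%N)// ?nnegrE ?normr_ge0 ?ler0c ?(ltW e0)//.
rewrite ell2_sqmod_norm -rmorphXn/= ltcR -lte_fin fineK//.
by apply: nnsum_fin (ell2P f) => x; exact: sqmod_ge0.
Qed.

Lemma sqmod_le_nnsum (f : X -> C) x :
  ((sqmod (f x))%:E <= nnsum (fun x => sqmod (f x)))%E.
Proof.
apply: ereal_sup_ubound; exists [set x]; last by rewrite fsbig_set1.
by split=> //; exact: finite_set1.
Qed.

Lemma ell2_complete (F : set_system (ell2 R X)) :
  ProperFilter F -> cauchy F -> cvg F.
Proof.
move=> FF /cauchyP Fc.
have Fball (e : R) : 0 < e -> exists f : ell2 R X,
    F [set g | (nnsum (fun x => sqmod (f x - g x)%R) < (e ^+ 2)%:E)%E].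
  move=> e0; have [|f Ff] := Fc (e%:C)%C; first by rewrite (ltcR 0).
  exists f; apply: filterS Ff => g.
  by rewrite -ball_normE /= ell2_norm_lt.
have Fx (x : X) (e : R) : 0 < e -> exists f : ell2 R X,
    F [set g | sqmod (f x - g x) < e ^+ 2].
  move=> e0; have [f Ff] := Fball e e0; exists f; apply: filterS Ff => g /=.
  by rewrite -lte_fin; apply: le_lt_trans; exact: (sqmod_le_nnsum (f - g)).
have /choice[a Fa] (x : X) : exists l : R, (fun f : ell2 R X => complex.Re (f x)) @ F --> l.
  apply: cauchy_coord => e e0; have [f Ff] := Fx x e e0.
  by exists f; apply: filterS Ff => g /= /(Re_sqmod e0); rewrite ReD.
have /choice[b Fb] (x : X) : exists l : R, (fun f : ell2 R X => complex.Im (f x)) @ F --> l.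
  apply: cauchy_coord => e e0; have [f Ff] := Fx x e e0.
  by exists f; apply: filterS Ff => g /= /(Im_sqmod e0); rewrite ImD.
pose l x : C := Complex (a x) (b x).
have Fl (e : R) : 0 < e -> exists2 f : ell2 R X,
    F [set g | (nnsum (fun x => sqmod (f x - g x)%R) < (e ^+ 2)%:E)%E] &
    (nnsum (fun x => sqmod (f x - l x)%R) <= (e ^+ 2)%:E)%E.
  move=> e0; have [f Ff] := Fball e e0; exists f => //.
  apply: ge_ereal_sup => _ [A [finA _] <-].
  rewrite fsbig_finite//= sumEFin lee_fin.
  have cv : (fun g : ell2 R X => \sum_(x <- fset_set A) sqmod (f x - g x)) @ F -->
      \sum_(x <- fset_set A) sqmod (f x - l x).
    apply: cvg_big => [|x _]; first exact: add_continuous.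
    rewrite sqmodE ReD ImD.
    under eq_fun do rewrite sqmodE ReD ImD.
    apply: cvgD; rewrite expr2; under eq_fun do rewrite expr2.
      by apply: cvgM; apply: cvgB; [exact: cvg_cst|exact: Fa|exact: cvg_cst|exact: Fa].
    by apply: cvgM; apply: cvgB; [exact: cvg_cst|exact: Fb|exact: cvg_cst|exact: Fb].
  rewrite -(cvg_lim _ cv)//; apply: limr_le; first by apply/cvg_ex; eexists; exact: cv.
  apply: filterS Ff => g /= fg; rewrite -lee_fin -sumEFin.
  apply: (@le_trans _ _ (\sum_(x \in A) (sqmod (f x - g x)%R)%:E)%E).
    by rewrite [leRHS]fsbig_finite.
  apply: le_trans (ltW fg).
  by apply: ereal_sup_ubound; exists A.
have [f0 _ f0l] := Fl 1 ltr01.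
have Sl : sq_summable l.
  pose h : X -> C := fun x => f0 x - l x.
  rewrite (_ : l = (f0 : X -> C) + (-1 : C) *: h); last first.
    by apply/funext => x; rewrite -[RHS]/(f0 x + (-1) * (f0 x - l x)); ring.
  apply: sq_summableD (ell2P f0) _; apply: sq_summableZ.
  by apply: le_lt_trans f0l _; rewrite ltry.
have lP : l \in @ell2_pred R X by exact/asboolP.
apply/cvg_ex; exists (Ell2 lP); apply/cvgrPdist_lt => e /gt0_complexE[r r0 ->].
have r2 : 0 < r / 2 by rewrite divr_gt0.
have r3 : 0 < r / 3 by rewrite divr_gt0.
have [f Ff fl] := Fl _ r3.
apply: filterS Ff => g /= fg.
rewrite (_ : Ell2 lP - g = (f - g) - (f - Ell2 lP)); last first.
  by rewrite opprB [RHS]addrC subrKA.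
apply: (le_lt_trans (ler_normB _ _)).
rewrite (_ : r%:C%C = (r / 2)%:C%C + (r / 2)%:C%C); last first.
  by rewrite -rmorphD/= -splitr.
rewrite ltrD// ell2_norm_lt//.
- by apply: lt_trans fg _; rewrite lte_fin; nra.
- by apply: le_lt_trans fl _; rewrite lte_fin; nra.
Qed.

HB.instance Definition _ := Uniform_isComplete.Build (ell2 R X) ell2_complete.

Definition ell2_hilbert : hilbert R :=
  @Hilbert R (ell2 R X) (@ell2_dot R X) (@ell2_normE R X).

End Ell2Complete.

Section ComplexHilbert.
Variable R : realType.
Local Notation C := R[i].

Definition complex_dot (z w : cplane R) : C := (z : C) * (w : C)^*.

Lemma complex_dot_bilinear : bilinear_for *%R (Num.conj \; *%R) complex_dot.
Proof.
split=> [w c z1 z2|z c w1 w2] /=; rewrite /complex_dot.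
  by rewrite mulrDl -mulrA.
by rewrite rmorphD rmorphM/= mulrDr mulrCA.
Qed.

HB.instance Definition _ := @bilinear_isBilinear.Build
  C (cplane R) (cplane R) C *%R (Num.conj \; *%R) complex_dot complex_dot_bilinear.

Lemma complex_dot_hermitian (z w : cplane R) :
  complex_dot z w = (-1) ^+ false * (complex_dot w z)^*.
Proof. by rewrite expr0 mul1r /complex_dot rmorphM/= conjCK mulrC. Qed.

HB.instance Definition _ := isHermitianSesquilinear.Build
  C (cplane R) false Num.conj complex_dot complex_dot_hermitian.

Lemma complex_dot_gt0 (z : cplane R) : z != 0 -> 0 < complex_dot z z.
Proof. by move=> z0; rewrite /complex_dot -normCK exprn_gt0// normr_gt0. Qed.

HB.instance Definition _ := isDotProduct.Build C (cplane R) complex_dot complex_dot_gt0.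

Lemma complex_normE (z : cplane R) : `|z| ^+ 2 = complex_dot z z.
Proof. exact: normCK. Qed.

Definition complex_hilbert : hilbert R := @Hilbert R (cplane R) complex_dot complex_normE.

End ComplexHilbert.

Record unirep (R : realType) (G : groupType) := Unirep {
  uspace :> hilbert R;
  uact : G -> {linear uspace -> uspace};
  uact1 : forall x, uact 1%g x = x;
  uactM : forall g h x, uact (g * h)%g x = uact g (uact h x);
  uact_dot : forall g x y,
    hdot uspace (uact g x) (uact g y) = hdot uspace x y }.

Definition irreducible (R : realType) (G : groupType) (p : unirep R G) :=
  (exists x : p, x != 0) /\
  forall W : set p, closed W -> W 0 ->
    (forall (c : R[i]) x y, W x -> W y -> W (c *: x + y)) ->
    (forall g x, W x -> W (uact p g x)) ->
    W = [set 0] \/ W = setT.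

Section MaximalCstar.
Variables (R : realType) (G : groupType).

Definition group_algebra : set (G -> R[i]) :=
  [set a | finite_set [set g | a g != 0]].

Definition galg_ext (p : unirep R G) (a : G -> R[i]) (x : p) : p :=
  \sum_(g \in [set: G]) a g *: uact p g x.

(* The norms of the Hilbert spaces take (nonnegative real) values in [R[i]],
   hence the projection to [R]. *)
Definition opnorm (H : hilbert R) (T : H -> H) : R :=
  sup [set complex.Re `|T x| | x in [set x : H | `|x| <= 1]].

(* The norm of C[G] whose completion is the maximal C*-algebra C*(G). *)
Definition max_norm (a : G -> R[i]) : R :=
  sup [set r | exists p : unirep R G, r = opnorm (galg_ext (p := p) a)].

(* An element of C*(G), the completion of C[G] for [max_norm], given by a Cauchy
   sequence in C[G]. Two sequences represent the same element of C*(G) when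
   [max_norm] of their difference tends to 0; [cstar_ext] below, hence the
   quantification over C*(G) in [weakly_contained], does not depend on the
   representative. *)
Record max_cstar := MaxCstar {
  cstar_seq :> nat -> G -> R[i];
  cstar_alg : forall n, group_algebra (cstar_seq n);
  cstar_cauchy : forall e : R, 0 < e -> exists N, forall m n,
    (N <= m)%N -> (N <= n)%N -> max_norm (cstar_seq m - cstar_seq n) < e }.

(* The extension of [p] to C*(G); the limit exists since the operator norm of
   [galg_ext p a] is at most [max_norm a]. *)
Definition cstar_ext (p : unirep R G) (a : max_cstar) (x : p) : p :=
  lim ((fun n => galg_ext (a n) x) @ \oo).

Definition weakly_contained (p q : unirep R G) :=
  forall a : max_cstar,
    opnorm (cstar_ext (p := p) a) <= opnorm (cstar_ext (p := q) a).

Definition weakly_equivalent (p q : unirep R G) :=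
  weakly_contained p q /\ weakly_contained q p.

Record irrep := Irrep { irrep_rep :> unirep R G; _ : irreducible irrep_rep }.

(* Weak equivalence classes are plain predicates, because [irrep] lives in too
   large a universe for [set]. *)
Definition weak_class (p : irrep) : irrep -> Prop :=
  fun q => weakly_equivalent q p.

Definition Prim := {c : irrep -> Prop | exists p, c = weak_class p}.

Definition prim_class (p : irrep) : Prim :=
  exist _ (weak_class p) (ex_intro _ p erefl).

End MaximalCstar.

Section TrivialRep.
Variables (R : realType) (G : groupType).

Definition trivial_rep : unirep R G :=
  @Unirep R G (complex_hilbert R) (fun=> idfun)
    (fun=> erefl) (fun _ _ _ => erefl) (fun _ _ _ => erefl).

End TrivialRep.

Record gaction (G : groupType) (X : Type) := Gaction {
  gact :> G -> X -> X;
  gact1 : forall x, gact 1%g x = x;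
  gactM : forall g h x, gact (g * h)%g x = gact g (gact h x) }.

Section PermRep.
Variables (R : realType) (G : groupType) (X : choiceType) (act : gaction G X).

Lemma gactK g : cancel (act g) (act g^-1%g).
Proof. by move=> x; rewrite -gactM mulVg gact1. Qed.

Lemma gactVK g : cancel (act g^-1%g) (act g).
Proof. by move=> x; rewrite -gactM mulgV gact1. Qed.

Lemma nnsum_perm g (p : X -> R) : (forall x, 0 <= p x) ->
  nnsum (fun x => p (act g x)) = nnsum p.
Proof.
move=> _; apply/esym; rewrite /nnsum; apply: reindex_esum; split=> //.
  by move=> x y _ _; exact: (can_inj (gactK g)).
by move=> y _; exists (act g^-1%g y) => //; exact: gactVK.
Qed.

Lemma rsum_perm g (f : X -> R) : rsum (fun x => f (act g x)) = rsum f.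
Proof.
rewrite /rsum (nnsum_perm g (p := fun x => Num.max (f x) 0)).
  rewrite (nnsum_perm g (p := fun x => Num.max (- f x) 0))// => x.
  by rewrite le_max lexx orbT.
by move=> x; rewrite le_max lexx orbT.
Qed.

Lemma perm_ell2P g (f : ell2 R X) : (fun x => f (act g^-1%g x)) \in @ell2_pred R X.
Proof.
apply/asboolP; rewrite /sq_summable.
rewrite (nnsum_perm g^-1%g (p := fun x => sqmod (f x))); first exact: ell2P.
by move=> x; exact: sqmod_ge0.
Qed.

(* The natural representation of [G] on l^2(X): (g f)(x) = f(g^-1 x). *)
Definition perm_op g (f : ell2_hilbert R X) : ell2_hilbert R X :=
  Ell2 (perm_ell2P g f).

Lemma perm_op_linear g : linear (perm_op g).
Proof. by move=> c f h; apply/val_inj. Qed.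

HB.instance Definition _ g :=
  GRing.isLinear.Build R[i] (ell2_hilbert R X) (ell2_hilbert R X) _ (perm_op g)
    (perm_op_linear g).

Lemma perm_op1 f : perm_op 1%g f = f.
Proof. by apply/val_inj/funext => x /=; rewrite invg1 gact1. Qed.

Lemma perm_opM g h f : perm_op (g * h)%g f = perm_op g (perm_op h f).
Proof. by apply/val_inj/funext => x /=; rewrite invgM gactM. Qed.

Lemma perm_op_dot g f h :
  hdot (ell2_hilbert R X) (perm_op g f) (perm_op g h) =
  hdot (ell2_hilbert R X) f h.
Proof.
rewrite /= /ell2_dot /csum.
rewrite -(rsum_perm g^-1%g (fun x => complex.Re (f x * (h x)^*))).
by rewrite -(rsum_perm g^-1%g (fun x => complex.Im (f x * (h x)^*))).
Qed.

Definition perm_rep : unirep R G := @Unirep R G (ell2_hilbert R X)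
  (fun g => perm_op g : {linear _ -> _}) perm_op1 perm_opM perm_op_dot.

Definition spectral_gap := ~ weakly_contained (trivial_rep R G) perm_rep.

End PermRep.

Section Subgroups.
Variables (G : groupType).
Implicit Types (H : groupClosed G).

Definition subgroup_type H := {x : G | x \in H}.

Lemma subgroup_closed H : group_closed (fun x : G => x \in H).
Proof. by split=> [|x y]; [exact: gpred1|exact: gpredF]. Qed.

HB.instance Definition _ H := SubChoice.on (subgroup_type H).
HB.instance Definition _ H :=
  SubChoice_isSubGroup.Build G _ (subgroup_type H) (subgroup_closed H).

Definition ltrans (g : G) (A : set G) : set G := [set (g * a)%g | a in A].

(* G/H, as a set of subsets of [G]. *)
Definition left_cosets H : set (set G) := [set ltrans g [set` H] | g in [set: G]].

Lemma ltrans1 A : ltrans 1%g A = A.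
Proof.
by apply/seteqP; split=> [_ [a Aa <-]|a Aa]; [rewrite mul1g|exists a; rewrite ?mul1g].
Qed.

Lemma ltransM g h A : ltrans (g * h)%g A = ltrans g (ltrans h A).
Proof.
apply/seteqP; split=> [_ [a Aa <-]|_ [_ [a Aa <-] <-]].
  by exists (h * a)%g; [exists a|rewrite mulgA].
by exists a => //; rewrite mulgA.
Qed.

Lemma ltransH H (h : G) : h \in H -> ltrans h [set` H] = [set` H].
Proof.
move=> Hh; apply/seteqP; split=> [_ [a Ha <-]|a Ha] /=; first exact: gpredM.
exists (h^-1 * a)%g; last by rewrite mulVKg.
by rewrite /= gpredMl ?gpredV.
Qed.

Lemma left_cosets_ltrans H g (A : left_cosets H) :
  ltrans g (val A) \in left_cosets H.
Proof.
apply/mem_set; have /set_mem[x _ <-] := valP A.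
by exists (g * x)%g; rewrite ?ltransM.
Qed.

Definition coset_act_fun H g (A : left_cosets H) : left_cosets H :=
  exist _ (ltrans g (val A)) (left_cosets_ltrans g A).

Lemma coset_act1 H A : @coset_act_fun H 1%g A = A.
Proof. by apply/val_inj; exact: ltrans1. Qed.

Lemma coset_actM H g h A :
  @coset_act_fun H (g * h)%g A = coset_act_fun g (coset_act_fun h A).
Proof. by apply/val_inj; exact: ltransM. Qed.

Definition coset_act H : gaction G (left_cosets H) :=
  Gaction (@coset_act1 H) (@coset_actM H).

(* G/H \ {H} *)
Definition nontrivial_left_cosets H := left_cosets H `\ [set` H].

Lemma nontrivial_ltrans H (h : subgroup_type H) (A : nontrivial_left_cosets H) :
  ltrans (val h) (val A) \in nontrivial_left_cosets H.
Proof.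
have /set_mem[[x _ Ax] AH] := valP A; apply/mem_set; split.
  by exists (val h * x)%g; rewrite // ltransM Ax.
move=> hA; apply: AH => /=.
rewrite -(ltrans1 (val A)) -(mulVg (val h)) ltransM hA ltransH//.
by rewrite gpredV; exact: (valP h).
Qed.

Definition nontrivial_coset_act_fun H h (A : nontrivial_left_cosets H) :
    nontrivial_left_cosets H :=
  exist _ (ltrans (val h) (val A)) (nontrivial_ltrans h A).

Lemma nontrivial_coset_act1 H A : @nontrivial_coset_act_fun H 1%g A = A.
Proof. by apply/val_inj; exact: ltrans1. Qed.

Lemma nontrivial_coset_actM H g h A :
  @nontrivial_coset_act_fun H (g * h)%g A =
  nontrivial_coset_act_fun g (nontrivial_coset_act_fun h A).
Proof. by apply/val_inj; exact: ltransM. Qed.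

Definition nontrivial_coset_act H :
    gaction (subgroup_type H) (nontrivial_left_cosets H) :=
  Gaction (@nontrivial_coset_act1 H) (@nontrivial_coset_actM H).

End Subgroups.

Section SpectralGapSubgroups.
Variables (R : realType) (G : groupType).

Definition quasi_regular (H : groupClosed G) : unirep R G :=
  perm_rep R (coset_act H).

Definition spectral_gap_property (H : groupClosed G) :=
  spectral_gap R (nontrivial_coset_act H).

Definition Sub_sg := {H : groupClosed G | spectral_gap_property H}.

(* [K] is g H g^-1; recall that x ^ g is g^-1 x g. *)
Definition conj_class (H : Sub_sg) : Sub_sg -> Prop :=
  fun K => exists g : G, forall x, (x \in sval K) = ((x ^ g)%g \in sval H).

Definition Sub_sg_conj := {c : Sub_sg -> Prop | exists H, c = conj_class H}.

Definition conj_quotient (H : Sub_sg) : Sub_sg_conj :=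
  exist _ (conj_class H) (ex_intro _ H erefl).

End SpectralGapSubgroups.

(* Main.v *)
Require Import Defs.
From HB Require Import structures.
From mathcomp Require Import all_boot all_order all_algebra.
From mathcomp Require Import finmap complex lra.
From mathcomp Require Import all_classical reals ereal topology normedtype.
From mathcomp Require Import sequences esum.

Set Implicit Arguments.
Unset Strict Implicit.
Unset Printing Implicit Defensive.

Import Order.TTheory GRing.Theory Num.Theory.
Import numFieldNormedType.Exports.

Local Open Scope classical_set_scope.
Local Open Scope ring_scope.

(** Let [H] and [L] have the spectral gap property. The assertions are that
    [quasi_regular R H] is irreducible, and that [quasi_regular R H] and
    [quasi_regular R L] are weakly equivalent exactly when [H] and [L] are conjugate.

    The spectral gap yields a finitely supported [s] in C[H] with coefficients of
    sum 1 that acts as a strict contraction on the functions on G/H vanishing at the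
    coset [H] ([spectral_gap_element]). As [s] fixes the point mass at [H], its
    powers converge in operator norm, on l^2(G/H), to the projection onto that point
    mass ([gap_pow]). The projection thus preserves every closed invariant subspace,
    and irreducibility follows since the point mass is a cyclic vector
    ([gap_irreducible]).

    Conjugate subgroups have isomorphic coset spaces, hence equivalent quasi-regular
    representations ([conjugate_weakly_equivalent]). Conversely, weakly equivalent
    representations give the same norm to every element of C[G]. If l^2(G/L) is weakly
    equivalent to l^2(G/H), the powers of [s] therefore converge in norm on l^2(G/L)
    too, to a nonzero operator whose values are [H]-invariant
    ([gap_fixed_vector]). An [H]-invariant square summable function
    on G/L lives on finite [H]-orbits, so some coset [g L] has a finite orbit under
    [H], that is, [H g] is covered by finitely many left translates of [L]
    ([weakly_equivalent_covered]). By symmetry [L k] is covered by finitely many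
    left translates of [H] for some [k]. On the other hand, a finite orbit of [H] on
    G/H other than the point [H] would carry an invariant vector and violate the
    spectral gap ([gap_self_covered]). Combining the coverings shows that [H] and
    [g L g^-1] are equal ([covered_conjugate]). *)

(** * Real-valued norms and operator norms *)

Section RealNorm.
Variable R : realType.
Local Notation C := R[i].

(** The norms of [R[i]] and of Hilbert spaces are [R[i]]-valued; their real
    counterparts make estimates accessible to [lra]. *)
Definition cmod (z : C) : R := complex.Re `|z|.
Definition nrm (H : hilbert R) (x : H) : R := complex.Re `|x|.

Lemma ge0_ReK (z : C) : 0 <= z -> (complex.Re z)%:C%C = z.
Proof. by case: z => a b; rewrite lecE /= => /andP[/eqP->]. Qed.

Lemma cmodE (z : C) : `|z| = (cmod z)%:C%C.
Proof. by rewrite ge0_ReK. Qed.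

Lemma nrmE (H : hilbert R) (x : H) : `|x| = (nrm x)%:C%C.
Proof. by rewrite ge0_ReK. Qed.

Lemma cmod_ge0 (z : C) : 0 <= cmod z.
Proof. by rewrite -ler0c -cmodE. Qed.

Lemma cmod_gt0 (z : C) : (0 < cmod z) = (z != 0).
Proof. by rewrite -(ltcR 0) -cmodE normr_gt0. Qed.

Lemma cmod0 : cmod 0 = 0.
Proof. by rewrite /cmod normr0. Qed.

Lemma cmodV (z : C) : cmod z^-1 = (cmod z)^-1.
Proof.
by apply: (@complexI R); rewrite fmorphV/= -!cmodE normfV.
Qed.

Variable H : hilbert R.
Implicit Types x y : H.

Lemma nrm_ge0 x : 0 <= nrm x.
Proof. by rewrite -ler0c -nrmE. Qed.

Lemma nrm0 : nrm (0 : H) = 0.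
Proof. by rewrite /nrm normr0. Qed.

Lemma nrm_eq0 x : nrm x = 0 -> x = 0.
Proof. by move=> x0; apply/normr0_eq0; rewrite nrmE x0. Qed.

Lemma nrm_gt0 x : x != 0 -> 0 < nrm x.
Proof. by rewrite -(ltcR 0) -nrmE normr_gt0. Qed.

Lemma nrmD x y : nrm (x + y) <= nrm x + nrm y.
Proof. by rewrite -lecR rmorphD/= -!nrmE ler_normD. Qed.

Lemma nrmN x : nrm (- x) = nrm x.
Proof. by rewrite /nrm normrN. Qed.

Lemma nrmBC x y : nrm (x - y) = nrm (y - x).
Proof. by rewrite -nrmN opprB. Qed.

Lemma nrm_tri x y z : nrm (x - z) <= nrm (x - y) + nrm (y - z).
Proof. by have := nrmD (x - y) (y - z); rewrite subrKA. Qed.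

Lemma nrm_sub x y : nrm x <= nrm y + nrm (x - y).
Proof. by have := nrmD y (x - y); rewrite subrKC. Qed.

Lemma nrmZ (c : C) x : nrm (c *: x) = cmod c * nrm x.
Proof.
by apply: (@complexI R); rewrite rmorphM/= -cmodE -!nrmE normrZ.
Qed.

Lemma nrm_sum (I : Type) (s : seq I) (F : I -> H) :
  nrm (\sum_(i <- s) F i) <= \sum_(i <- s) nrm (F i).
Proof.
elim: s => [|i s IH]; first by rewrite !big_nil nrm0.
by rewrite !big_cons; apply: le_trans (nrmD _ _) _; rewrite lerD2l.
Qed.

Lemma norm_le1 x : (`|x| <= 1) = (nrm x <= 1).
Proof. by rewrite nrmE -[1 in LHS]/(1%:C%C) lecR. Qed.

Lemma nrm_cvgP (u : nat -> H) (l : H) :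
  u @ \oo --> l <->
  forall e : R, 0 < e -> exists N, forall n, (N <= n)%N -> nrm (u n - l) <= e.
Proof.
split=> [/cvgrPdist_le ul e e0|ul].
  have [|N _ Nu] := ul e%:C%C; first by rewrite (ltcR 0).
  by exists N => n Nn; rewrite nrmBC -lecR -nrmE; exact: Nu.
apply/cvgrPdist_le => e /gt0_complexE[r r0 ->].
have [N Nu] := ul r r0; exists N => // n Nn /=.
by rewrite nrmE lecR nrmBC; exact: Nu.
Qed.

(** Completeness, in the form used for limits of operators at a vector. *)
Lemma nrm_cauchy (u : nat -> H) :
  (forall e : R, 0 < e -> exists N, forall n m,
     (N <= n)%N -> (N <= m)%N -> nrm (u n - u m) <= e) ->
  cvg (u @ \oo).
Proof.
move=> uc; apply: cauchy_cvg; apply/cauchyP => e /gt0_complexE[r r0 ->].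
have [|N Nu] := uc (r / 2); first by rewrite divr_gt0.
exists (u N); exists N => // n /= Nn; rewrite -ball_normE /= nrmE ltcR.
by rewrite (le_lt_trans (Nu _ _ _ _))// ltr_pdivrMr// ltr_pMr// ltr1n.
Qed.

Definition bounded_by (M : R) (T : H -> H) := forall x, nrm (T x) <= M * nrm x.

Lemma opnorm_le M T : (forall x, nrm x <= 1 -> nrm (T x) <= M) -> opnorm T <= M.
Proof.
move=> TM; apply: ge_sup; last first.
  by move=> _ [x x1 <-]; apply: TM; rewrite -norm_le1.
by exists (nrm (T 0)); exists 0 => //=; rewrite normr0 ler01.
Qed.

(** A bound [M] has to be known beforehand: the supremum defining [opnorm] is
    meaningless for an unbounded map. *)
Lemma opnorm_ub M T x : 0 <= M -> bounded_by M T -> nrm x <= 1 ->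
  nrm (T x) <= opnorm T.
Proof.
move=> M0 TM x1; apply: ub_le_sup; last by exists x => //=; rewrite norm_le1.
exists M => _ [y y1 <-]; apply: le_trans (TM y) _.
by rewrite -[leRHS]mulr1 ler_wpM2l// -norm_le1.
Qed.

Lemma opnorm_bounded M T : (forall c x, T (c *: x) = c *: T x) -> 0 <= M ->
  bounded_by M T -> bounded_by (opnorm T) T.
Proof.
move=> TZ M0 TM x; have [->|x0] := eqVneq x 0.
  by rewrite -(scale0r 0) TZ !nrmZ cmod0 !mul0r mulr0.
have nx := nrm_gt0 x0.
have := @opnorm_ub M T ((nrm x)^-1%:C%C *: x) M0 TM.
rewrite TZ !nrmZ.
have -> : cmod (nrm x)^-1%:C%C = (nrm x)^-1.
  by rewrite /cmod normc_def/= expr0n/= addr0 sqrtr_sqr ger0_norm// invr_ge0 ltW.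
rewrite mulVf ?gt_eqF// lexx => /(_ isT).
by rewrite mulrC ler_pdivrMr.
Qed.

Lemma opnorm_le_bound M T : 0 <= M -> bounded_by M T -> opnorm T <= M.
Proof.
move=> M0 TM; apply: opnorm_le => x x1; apply: le_trans (TM x) _.
by rewrite -[leRHS]mulr1 ler_wpM2l.
Qed.

Lemma opnorm_ge0 M T : 0 <= M -> bounded_by M T -> 0 <= opnorm T.
Proof.
move=> M0 TM; apply: le_trans (nrm_ge0 (T 0)) _.
by apply: (opnorm_ub M0 TM); rewrite nrm0 ler01.
Qed.

End RealNorm.

(** * Formal sums and weak containment *)

Section FormalSums.
Variables (R : realType) (G : groupType).
Local Notation C := R[i].
Local Notation fsum := (seq (C * G)).
Implicit Types (p : unirep R G) (s t : fsum).

Lemma nrm_uact p g (x : p) : nrm (uact p g x) = nrm x.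
Proof.
rewrite /nrm; congr complex.Re; apply/eqP.
by rewrite -(@eqrXn2 _ 2)// !hnormE uact_dot.
Qed.

(** A formal sum [(c_1, g_1), ..., (c_n, g_n)] stands for the element
    [c_1 g_1 + ... + c_n g_n] of the group algebra. On formal sums the product is
    a list of pairwise products, which avoids reindexing convolutions. *)
Definition fs_act p s (x : p) : p := \sum_(u <- s) u.1 *: uact p u.2 x.

Definition fs_size s : R := \sum_(u <- s) cmod u.1.

Definition fs_fun s (g : G) : C := \sum_(u <- s | u.2 == g) u.1.

Definition fs_mul s t : fsum := [seq (u.1 * v.1, (u.2 * v.2)%g) | u <- s, v <- t].

Definition fs_scale (c : C) s : fsum := [seq (c * u.1, u.2) | u <- s].

Definition fs_pow s n : fsum := iter n (fs_mul s) [:: (1, 1%g)].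

Lemma fs_actD p s x y : fs_act s (x + y) = fs_act s x + fs_act s y :> p.
Proof.
by rewrite -big_split; apply: eq_bigr => u _; rewrite linearD scalerDr.
Qed.

Lemma fs_actZ p s c x : fs_act s (c *: x) = c *: fs_act s x :> p.
Proof.
rewrite scaler_sumr; apply: eq_bigr => u _.
by rewrite linearZ /= !scalerA mulrC.
Qed.

Lemma fs_actN p s x : fs_act s (- x) = - fs_act s x :> p.
Proof. by rewrite -scaleN1r fs_actZ scaleN1r. Qed.

Lemma fs_actB p s x y : fs_act s (x - y) = fs_act s x - fs_act s y :> p.
Proof. by rewrite fs_actD fs_actN. Qed.

Lemma fs_act_cat p s t x : fs_act (s ++ t) x = fs_act s x + fs_act t x :> p.
Proof. exact: big_cat. Qed.

Lemma fs_act1 p c g x : fs_act [:: (c, g)] x = c *: uact p g x.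
Proof. exact: big_seq1. Qed.

Lemma fs_act_scale p c s x : fs_act (fs_scale c s) x = c *: fs_act s x :> p.
Proof.
rewrite /fs_act big_map scaler_sumr; apply: eq_bigr => u _.
by rewrite scalerA.
Qed.

Lemma fs_act_mul p s t x : fs_act (fs_mul s t) x = fs_act s (fs_act t x) :> p.
Proof.
rewrite /fs_act /fs_mul big_allpairs_dep; apply: eq_bigr => u _.
rewrite linear_sum scaler_sumr; apply: eq_bigr => v _.
by rewrite linearZ/= scalerA uactM.
Qed.

Lemma fs_act_pow p s n x : fs_act (fs_pow s n) x = iter n (@fs_act p s) x.
Proof.
elim: n => [|n IH]; first by rewrite fs_act1 scale1r uact1.
by rewrite [fs_pow _ _]iterS fs_act_mul IH.
Qed.

Lemma fs_size_ge0 s : 0 <= fs_size s.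
Proof. by apply: sumr_ge0 => u _; exact: cmod_ge0. Qed.

Lemma fs_act_bounded p s : bounded_by (fs_size s) (@fs_act p s).
Proof.
move=> x; apply: le_trans (nrm_sum _ _) _.
by rewrite mulr_suml; apply: ler_sum => u _; rewrite nrmZ nrm_uact.
Qed.

Lemma fs_act_opnorm p s : bounded_by (opnorm (@fs_act p s)) (@fs_act p s).
Proof.
exact: opnorm_bounded (@fs_actZ p s) (fs_size_ge0 s) (@fs_act_bounded p s).
Qed.

Lemma fs_opnorm_ge0 p s : 0 <= opnorm (@fs_act p s).
Proof. exact: opnorm_ge0 (fs_size_ge0 s) (@fs_act_bounded p s). Qed.

(** The support of [a] may be enlarged to any duplicate-free list: this lets two
    elements of the group algebra be summed over the same list. *)
Lemma galg_ext_seq p (a : G -> C) (r : seq G) x : uniq r ->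
  (forall g, a g != 0 -> g \in r) ->
  galg_ext (p := p) a x = \sum_(g <- r) a g *: uact p g x.
Proof.
move=> ur ar; rewrite (bigfs _ ur) /galg_ext.
  by apply: eq_fsbigl; apply/seteqP.
by move=> g _; apply: contraNeq => h; apply: ar; apply: contra_neq h => ->; rewrite scale0r.
Qed.

Lemma group_algebraE (a : G -> C) : group_algebra a ->
  exists2 r : seq G, uniq r & forall g, a g != 0 -> g \in r.
Proof.
move=> fa; exists (fset_set [set g | a g != 0]); first exact: fset_uniq.
by move=> g ag; rewrite in_fset_set// inE.
Qed.

Lemma group_algebra_fs (a : G -> C) : group_algebra a ->
  exists s, forall p, galg_ext (p := p) a = @fs_act p s.
Proof.
move=> /group_algebraE[r ur ar]; exists [seq (a g, g) | g <- r] => p.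
by apply/funext => x; rewrite (galg_ext_seq _ ur ar) /fs_act big_map.
Qed.

Lemma fs_fun_supp s g : fs_fun s g != 0 -> g \in undup (unzip2 s).
Proof.
rewrite mem_undup; apply: contraNT => gs; apply/eqP; apply: big1_seq => u /andP[/eqP ug us].
by move: gs; rewrite -ug map_f.
Qed.

Lemma fs_fun_group_algebra s : group_algebra (fs_fun s).
Proof.
apply: (@sub_finite_set _ _ [set` undup (unzip2 s)]); last exact: finite_seq.
by move=> g; exact: fs_fun_supp.
Qed.

Lemma galg_ext_fs p s : galg_ext (p := p) (fs_fun s) = @fs_act p s.
Proof.
apply/funext => x; rewrite (galg_ext_seq _ (undup_uniq _) (@fs_fun_supp s)).
under eq_bigr do rewrite scaler_suml big_mkcond.
rewrite exchange_big /= [LHS]big_seq [RHS]big_seq; apply: eq_bigr => u us.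
rewrite (bigD1_seq u.2) ?undup_uniq ?mem_undup ?map_f//= eqxx big1 ?addr0//.
by move=> g gu; rewrite eq_sym (negbTE gu).
Qed.

(** The supremum over all representations is finite because the bound
    [fs_size s] does not depend on the representation. *)
Lemma le_max_norm p (a : G -> C) : group_algebra a ->
  opnorm (galg_ext (p := p) a) <= max_norm a.
Proof.
move=> /group_algebra_fs[s sE]; apply: ub_le_sup; last by exists p.
exists (fs_size s) => _ [q ->]; rewrite sE.
exact: opnorm_le_bound (fs_size_ge0 s) (@fs_act_bounded q s).
Qed.

Lemma group_algebraB (a b : G -> C) : group_algebra a -> group_algebra b ->
  group_algebra (a - b).
Proof.
move=> fa fb; apply: (@sub_finite_set _ _ ([set g | a g != 0] `|` [set g | b g != 0])).
  move=> g; rewrite /= -[(a - b) g]/(a g - b g).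
  by have [->|] := eqVneq (a g) 0; [rewrite sub0r oppr_eq0; right|left].
by rewrite finite_setU.
Qed.

Lemma galg_extB p (a b : G -> C) x : group_algebra a -> group_algebra b ->
  galg_ext (a - b) x = galg_ext a x - galg_ext b x :> p.
Proof.
move=> /group_algebraE[r1 _ ar1] /group_algebraE[r2 _ br2].
pose r := undup (r1 ++ r2).
have ar g : a g != 0 -> g \in r by move=> /ar1; rewrite mem_undup mem_cat => ->.
have br g : b g != 0 -> g \in r.
  by move=> /br2; rewrite mem_undup mem_cat orbC => ->.
rewrite !(@galg_ext_seq _ _ r) ?undup_uniq//; last first.
  move=> g; rewrite -[(a - b) g]/(a g - b g).
  by have [->|/ar//] := eqVneq (a g) 0; rewrite sub0r oppr_eq0 => /br.
by rewrite -sumrB; apply: eq_bigr => g _; rewrite -scalerBl.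
Qed.

Lemma galg_extB_le p (a b : G -> C) x : group_algebra a -> group_algebra b ->
  nrm (galg_ext a x - galg_ext b x : p) <= max_norm (a - b) * nrm x.
Proof.
move=> fa fb; have fab := group_algebraB fa fb.
rewrite -galg_extB//; apply: le_trans (ler_wpM2r (nrm_ge0 x) (le_max_norm p fab)).
by have [s ->] := group_algebra_fs fab; exact: fs_act_opnorm.
Qed.

(** One formal sum approximates an element of the maximal C*-algebra in all
    representations at once, since [max_norm] dominates every operator norm. *)
Lemma cstar_ext_approx (a : max_cstar R G) (e : R) : 0 < e ->
  exists s, forall p x, nrm (cstar_ext a x - fs_act s x : p) <= e * nrm x.
Proof.
move=> e0; have [N Na] := cstar_cauchy a e0.
have [s sE] := group_algebra_fs (cstar_alg a N).
exists s => p x; rewrite -sE.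
have cv : cvg ((fun n => galg_ext (a n) x : p) @ \oo).
  apply: nrm_cauchy => d d0.
  have [|M Ma] := cstar_cauchy a (e := d / (nrm x + 1)).
    by rewrite divr_gt0// ltr_wpDl// nrm_ge0.
  exists M => n m Mn Mm; apply: le_trans (galg_extB_le _ (cstar_alg a n) (cstar_alg a m)) _.
  apply: le_trans (ler_wpM2r (nrm_ge0 x) (ltW (Ma _ _ Mn Mm))) _.
  have x1 : 0 < nrm x + 1 by rewrite ltr_wpDl// nrm_ge0.
  by rewrite mulrAC ler_pdivrMr// ler_wpM2l ?(ltW d0)// lerDl.
apply/ler_addgt0Pr => d d0.
have /nrm_cvgP/(_ d d0)[M Ma] := cv.
apply: le_trans (nrm_tri _ (galg_ext (a (maxn M N)) x) _) _.
rewrite [leRHS]addrC; apply: lerD; first by rewrite nrmBC Ma ?leq_maxl.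
apply: le_trans (galg_extB_le _ (cstar_alg a _) (cstar_alg a _)) _.
by apply/(ler_wpM2r (nrm_ge0 x))/ltW/Na => //; rewrite leq_maxr.
Qed.

Lemma cstar_ext_bounded p (a : max_cstar R G) :
  exists2 M, 0 <= M & bounded_by M (@cstar_ext _ _ p a).
Proof.
have [s sE] := cstar_ext_approx a ltr01.
exists (fs_size s + 1) => [|x]; first by rewrite addr_ge0 ?fs_size_ge0.
apply: le_trans (nrm_sub _ (fs_act s x)) _.
by rewrite mulrDl lerD ?sE// fs_act_bounded.
Qed.

Lemma max_norm0 : max_norm (0 : G -> C) = 0.
Proof.
have E p : opnorm (galg_ext (p := p) 0) = 0.
  have -> : galg_ext (p := p) 0 = fun=> 0.
    by apply/funext => x; apply: fsbig1 => g _; rewrite scale0r.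
  apply/le_anti/andP; split.
    by apply: opnorm_le_bound => // x; rewrite nrm0 mul0r.
  by apply: (@opnorm_ge0 _ _ 0) => // x; rewrite nrm0 mul0r.
rewrite /max_norm (_ : [set r | _] = [set 0]) ?sup1//.
apply/seteqP; split=> [_ [p ->]|_ ->] /=; first exact: E.
by exists (trivial_rep R G); rewrite E.
Qed.

Definition fs_cstar s : max_cstar R G.
Proof.
apply: (@MaxCstar R G (fun=> fs_fun s) (fun=> fs_fun_group_algebra s)) => e e0.
by exists 0%N => m n _ _; rewrite subrr max_norm0.
Defined.

Lemma cstar_ext_fs p s : cstar_ext (fs_cstar s) = @fs_act p s.
Proof.
by apply/funext => x; rewrite /cstar_ext /= galg_ext_fs; exact: lim_cst.
Qed.

Lemma weakly_contained_fs p q s : weakly_contained p q ->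
  opnorm (@fs_act p s) <= opnorm (@fs_act q s).
Proof. by move=> /(_ (fs_cstar s)); rewrite !cstar_ext_fs. Qed.

(** A failure of weak containment is witnessed in the group algebra, because
    the latter is dense in the maximal C*-algebra. *)
Lemma not_weakly_contained_fs p q : ~ weakly_contained p q ->
  exists s, opnorm (@fs_act q s) < opnorm (@fs_act p s).
Proof.
move=> /existsNP[a /negP]; rewrite -ltNge => ltqp.
pose e := (opnorm (@cstar_ext _ _ p a) - opnorm (@cstar_ext _ _ q a)) / 3.
have e0 : 0 < e by rewrite divr_gt0// subr_gt0.
have [s sE] := cstar_ext_approx a e0; exists s.
have dist (r : unirep R G) (x : r) : nrm x <= 1 -> nrm (cstar_ext a x - fs_act s x) <= e.
  by move=> x1; apply: le_trans (sE r x) _; rewrite ger_pMr.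
have q_le : opnorm (@fs_act q s) <= opnorm (@cstar_ext _ _ q a) + e.
  apply: opnorm_le => x x1; apply: le_trans (nrm_sub _ (cstar_ext a x)) _.
  have [M M0 MT] := cstar_ext_bounded q a.
  by rewrite lerD ?(opnorm_ub M0 MT)// nrmBC dist.
have p_le : opnorm (@cstar_ext _ _ p a) <= opnorm (@fs_act p s) + e.
  apply: opnorm_le => x x1; apply: le_trans (nrm_sub _ (fs_act s x)) _.
  by rewrite lerD ?(opnorm_ub (fs_size_ge0 s) (@fs_act_bounded p s))// dist.
move: q_le p_le e0; rewrite /e; lra.
Qed.

(** [U] carries the unit ball of [p] into that of [q], so that the supremum defining
    the norm in [q] is taken over a larger set. *)
Lemma weakly_contained_sub (p q : unirep R G) (U : {linear p -> q}) :
  (forall x, nrm (U x) = nrm x) ->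
  (forall g x, U (uact p g x) = uact q g (U x)) -> weakly_contained p q.
Proof.
move=> Uiso Ueq; apply: contrapT => /not_weakly_contained_fs[s]; apply/negP.
rewrite -leNgt; apply: opnorm_le => x x1.
rewrite -Uiso (_ : U (fs_act s x) = fs_act s (U x)); last first.
  by rewrite linear_sum; apply: eq_bigr => u _; rewrite linearZ/= Ueq.
by apply: opnorm_ub (fs_size_ge0 s) (@fs_act_bounded q s) _; rewrite Uiso.
Qed.

Lemma weakly_equivalent_refl p : weakly_equivalent p p.
Proof. by split=> a. Qed.

Lemma weakly_equivalent_sym p q : weakly_equivalent p q -> weakly_equivalent q p.
Proof. by case. Qed.

Lemma weakly_equivalent_trans p q r :
  weakly_equivalent p q -> weakly_equivalent q r -> weakly_equivalent p r.
Proof.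
by move=> [pq qp] [qr rq]; split=> a; [exact: le_trans (qr a)|exact: le_trans (qp a)].
Qed.

End FormalSums.

(** * Square summable functions *)

Section SquareSummable.
Variable R : realType.
Local Notation C := R[i].

Lemma sqmod_cmod (z : C) : sqmod z = cmod z ^+ 2.
Proof. by apply: (@complexI R); rewrite sqmod_norm rmorphXn/= -cmodE. Qed.

Lemma nnsum_ell2 (X : choiceType) (f : ell2_hilbert R X) :
  nnsum (fun x => sqmod (f x)) = (nrm f ^+ 2)%:E.
Proof.
rewrite -[LHS]fineK; last first.
  by apply: nnsum_fin (ell2P f) => x; exact: sqmod_ge0.
congr EFin; apply: (@complexI R).
by rewrite -ell2_sqmod_norm rmorphXn/= -nrmE.
Qed.

Lemma nrm_ell2_le (X Y : choiceType) (f : ell2_hilbert R X) (h : ell2_hilbert R Y) :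
  (nnsum (fun x => sqmod (f x)) <= nnsum (fun x => sqmod (h x)))%E -> nrm f <= nrm h.
Proof.
by rewrite !nnsum_ell2 lee_fin ler_pXn2r// ?nnegrE ?nrm_ge0.
Qed.

(** A convergent series of nonnegative terms has finitely many terms above any
    positive level: this is what turns an invariant vector into a finite orbit. *)
Lemma nnsum_finite_level (X : choiceType) (p : X -> R) (e : R) : 0 < e ->
  (forall x, 0 <= p x) -> (nnsum p < +oo)%E -> finite_set [set x | e <= p x].
Proof.
move=> e0 p0 pfin; apply: contrapT => infin.
have [N Np] : exists N : nat, (nnsum p < (e *+ N)%:E)%E.
  have := nnsum_fin p0 pfin; case: (nnsum p) => // r _.
  exists (Num.bound `|r / e|); rewrite lte_fin -mulr_natr mulrC -ltr_pdivrMr//.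
  by apply: le_lt_trans (ler_norm _) _; rewrite archi_boundP.
have [A /= Ae AN] := infinite_set_fset N infin.
have : ((e *+ N)%:E <= nnsum p)%E.
  apply: esum_ge; exists [set` A]; first by split.
  rewrite fsbig_finite//= set_fsetK sumEFin lee_fin.
  apply: (@le_trans _ _ (\sum_(x <- A) e)).
    by rewrite big_const_seq count_predT iter_addr_0 ler_wpMn2l ?ltW.
  by rewrite big_seq [leRHS]big_seq; apply: ler_sum => x /Ae.
by rewrite leNgt Np.
Qed.

Lemma nnsum_inj (X Y : choiceType) (phi : X -> Y) (p : Y -> R) : injective phi ->
  nnsum (fun x => p (phi x)) = (\esum_(y in range phi) (p y)%:E)%E.
Proof. by move=> inj; rewrite esum_image// => x y _ _; exact: inj. Qed.

Lemma nnsum_inj_le (X Y : choiceType) (phi : X -> Y) (p : Y -> R) : injective phi ->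
  (forall y, 0 <= p y) -> (nnsum (fun x => p (phi x)) <= nnsum p)%E.
Proof.
move=> inj p0; rewrite nnsum_inj// esum_mkcond; apply: le_esum => y _.
by case: ifP; rewrite lee_fin.
Qed.

Lemma nnsum_inj_eq (X Y : choiceType) (phi : X -> Y) (p : Y -> R) : injective phi ->
  (forall y, ~ range phi y -> p y = 0) -> nnsum (fun x => p (phi x)) = nnsum p.
Proof.
move=> inj p0; rewrite nnsum_inj// esum_mkcond; apply: eq_esum => y _.
by case: ifPn => // /negP; rewrite inE => /p0 ->.
Qed.

Section Pullback.
Variables (X Y : choiceType) (phi : X -> Y) (inj : injective phi).

(** Composition with [phi] maps l^2(Y) to l^2(X). With a bijection [phi] it
    identifies the two spaces; with an inclusion it is the restriction to [X], and
    is isometric on the functions supported in [X]. *)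
Lemma pullback_ell2P (f : ell2 R Y) : (fun x => f (phi x)) \in @ell2_pred R X.
Proof.
apply/asboolP; apply: le_lt_trans (ell2P f).
by apply: (nnsum_inj_le (p := fun y => sqmod (f y))) => // y; exact: sqmod_ge0.
Qed.

Definition pullback (f : ell2_hilbert R Y) : ell2_hilbert R X := Ell2 (pullback_ell2P f).

Lemma pullback_linear : linear pullback.
Proof. by move=> c f h; apply/val_inj. Qed.

HB.instance Definition _ :=
  GRing.isLinear.Build R[i] (ell2_hilbert R Y) (ell2_hilbert R X) _ pullback
    pullback_linear.

Lemma nrm_pullback (f : ell2_hilbert R Y) :
  (forall y, ~ range phi y -> f y = 0) -> nrm (pullback f) = nrm f.
Proof.
move=> f0.
have E : nnsum (fun x => sqmod (pullback f x)) = nnsum (fun y => sqmod (f y)).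
  apply: (nnsum_inj_eq (p := fun y => sqmod (f y))) => // y /f0 ->.
  by rewrite /sqmod normr0 expr0n.
by apply/le_anti/andP; split; apply: nrm_ell2_le; rewrite E.
Qed.

End Pullback.

Variable X : choiceType.

Lemma sq_summable_finite (O : set X) (f : X -> C) :
  finite_set O -> (forall x, ~ O x -> f x = 0) -> sq_summable f.
Proof.
move=> finO f0; rewrite /sq_summable /nnsum.
rewrite (_ : esum _ _ = esum O (fun x => (sqmod (f x))%:E)); last first.
  rewrite [RHS]esum_mkcond; apply: eq_esum => x _; case: ifPn => // /negP.
  by rewrite inE => /f0 ->; rewrite /sqmod normr0 expr0n.
rewrite esum_fset//; last by move=> x _; rewrite lee_fin sqmod_ge0.
by rewrite fsbig_finite//= sumEFin ltry.
Qed.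

Lemma restrict_ell2P (O : set X) (f : X -> C) : finite_set O ->
  (fun x => if x \in O then f x else 0) \in @ell2_pred R X.
Proof.
move=> finO; apply/asboolP/(sq_summable_finite finO) => x.
by case: ifPn => // /set_mem.
Qed.

Definition finite_restrict (O : set X) (finO : finite_set O) (f : X -> C) :
  ell2_hilbert R X := Ell2 (restrict_ell2P f finO).

Definition point_mass (x : X) : ell2_hilbert R X := finite_restrict (finite_set1 x) (fun=> 1).

Lemma point_massE x y : point_mass x y = if y == x then 1 else 0.
Proof. by rewrite /= in_set1. Qed.

Lemma finite_restrict_sum (O : set X) (finO : finite_set O) f :
  finite_restrict finO f = \sum_(x <- fset_set O) f x *: point_mass x.
Proof.
apply/val_inj/funext => y.
have ev : {morph (fun h : ell2_hilbert R X => h y) : a b / a + b} by [].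
rewrite [RHS](big_morph (fun h : ell2_hilbert R X => h y) ev (erefl : (0 : ell2_hilbert R X) y = 0)).
transitivity (\sum_(x <- fset_set O) if x == y then f y else 0); last first.
  apply: eq_bigr => x _; rewrite -[RHS]/(f x * point_mass x y) point_massE eq_sym.
  by case: eqVneq => [->|]; rewrite ?mulr1 ?mulr0.
rewrite -big_mkcond /=; case: ifPn => yO.
  rewrite -big_filter (_ : [seq x <- _ | _] = [:: y]) ?big_seq1//.
  by apply: filter_pred1_uniq; rewrite ?fset_uniq ?in_fset_set.
by rewrite big1_seq// => x /andP[/eqP -> ]; rewrite in_fset_set// (negbTE yO).
Qed.

(** By definition of the unordered sum, a finite set [O] carries all but [e^2]
    of the mass of [f]; the squared norm of the truncation error is what is left. *)
Lemma finite_restrict_dense (f : ell2_hilbert R X) (e : R) : 0 < e ->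
  exists (O : set X) (finO : finite_set O), nrm (finite_restrict finO f - f) <= e.
Proof.
move=> e0; have p0 x : 0 <= sqmod (f x) by exact: sqmod_ge0.
have fin := nnsum_fin p0 (ell2P f).
have [_ [O [finO _] <-]] := ub_ereal_sup_adherent (exprn_gt0 2 e0) fin.
rewrite -[ereal_sup _]/(nnsum (fun x => sqmod (f x))) => fO.
exists O, finO; set h := finite_restrict _ _.
rewrite -(@ler_pXn2r _ 2)// ?nnegrE ?nrm_ge0 ?(ltW e0)// -lee_fin -nnsum_ell2.
have hE : (nnsum (fun x => sqmod (f x)) =
    nnsum (fun x => sqmod (h x)) + nnsum (fun x => sqmod ((h - f)%R x)))%E.
  rewrite -nnsumD; [|by move=> x; exact: sqmod_ge0..].
  congr nnsum; apply/funext => x; rewrite -[(h - f) x]/(h x - f x) /h /=.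
  by case: ifP => _; rewrite ?subrr ?sub0r ?sqmodN /sqmod normr0 expr0n/= ?addr0 ?add0r.
have hO : nnsum (fun x => sqmod (h x)) = (\sum_(x \in O) (sqmod (f x))%:E)%E.
  rewrite -esum_fset//; last by move=> x _; rewrite lee_fin.
  rewrite esum_mkcond; apply: eq_esum => x _ /=.
  by case: ifP => // _; rewrite /sqmod normr0 expr0n.
move: fO; rewrite hE hO.
have := nnsum_ell2 (h - f); move: (nnsum _) => a ->.
have -> : (\sum_(x \in O) (sqmod (f x))%:E = (\sum_(x <- fset_set O) sqmod (f x))%:E)%E.
  by rewrite fsbig_finite//= sumEFin.
rewrite -EFinD lte_fin lee_fin; lra.
Qed.

End SquareSummable.

(** * Permutation representations *)

Section PermutationRepresentations.
Variables (R : realType) (G : groupType).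
Local Notation C := R[i].
Local Notation fsum := (seq (C * G)).

Definition fs_sum (s : fsum) : C := \sum_(u <- s) u.1.

Lemma perm_fs_actE (X : choiceType) (act : gaction G X) (s : fsum)
    (f : perm_rep R act) x :
  (fs_act s f : ell2 R X) x = \sum_(u <- s) u.1 * (f : ell2 R X) (act u.2^-1%g x).
Proof.
have ev : {morph (fun h : ell2_hilbert R X => h x) : a b / a + b} by [].
by rewrite /fs_act (big_morph (fun h : ell2_hilbert R X => h x) ev
  (erefl : (0 : ell2_hilbert R X) x = 0)).
Qed.

Lemma fs_act_invariant (p : unirep R G) (s : fsum) (x : p) :
  (forall u, u \in s -> uact p u.2 x = x) -> fs_act s x = fs_sum s *: x.
Proof.
move=> xs; rewrite /fs_act scaler_suml big_seq [RHS]big_seq.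
by apply: eq_bigr => u /xs ->.
Qed.

(** In the trivial representation [s] acts as the scalar [fs_sum s], so that a
    failure of weak containment gives [s] with [`|fs_sum s|] larger than the norm of
    [s] on l^2(X); dividing by [fs_sum s] normalises it. *)
Lemma spectral_gap_fs (X : choiceType) (act : gaction G X) : spectral_gap R act ->
  exists s, fs_sum s = 1 /\ opnorm (@fs_act _ _ (perm_rep R act) s) < 1.
Proof.
move=> /not_weakly_contained_fs[s].
set q := perm_rep R act; set c := fs_sum s => lt_q.
have triv_le : opnorm (@fs_act _ _ (trivial_rep R G) s) <= cmod c.
  apply: opnorm_le_bound; first exact: cmod_ge0.
  by move=> x; rewrite fs_act_invariant// nrmZ.
have lt_c := lt_le_trans lt_q triv_le.
have c0 : c != 0.
  by rewrite -cmod_gt0; apply: le_lt_trans lt_c; exact: fs_opnorm_ge0.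
exists (fs_scale c^-1 s); split.
  by rewrite /fs_sum big_map /= -mulr_sumr mulVf.
have cc0 : 0 < cmod c by rewrite cmod_gt0.
apply: (@le_lt_trans _ _ (opnorm (@fs_act _ _ q s) / cmod c)); last first.
  by rewrite ltr_pdivrMr ?mul1r.
apply: opnorm_le_bound; first by rewrite divr_ge0 ?fs_opnorm_ge0 ?(ltW cc0).
move=> x; rewrite fs_act_scale nrmZ cmodV mulrAC mulrC ler_pM2r ?invr_gt0//.
exact: fs_act_opnorm.
Qed.

Lemma equivariant_weakly_contained (X Y : choiceType) (aX : gaction G X)
    (aY : gaction G Y) (phi : X -> Y) : bijective phi ->
  (forall g x, phi (aX g x) = aY g (phi x)) ->
  weakly_contained (perm_rep R aY) (perm_rep R aX).
Proof.
move=> bij phiE; have inj := bij_inj bij.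
apply: (@weakly_contained_sub _ _ (perm_rep R aY) (perm_rep R aX)
  (pullback inj : {linear ell2_hilbert R Y -> ell2_hilbert R X})).
  move=> f; apply: nrm_pullback => y; case: bij => psi _ psiK.
  by case; exists (psi y) => //; exact: psiK.
move=> g f; apply/val_inj/funext => x /=.
by rewrite phiE.
Qed.

(** The indicator function of [O] is an invariant vector, hence is fixed by any [s]
    with [fs_sum s = 1]; such an [s] cannot be a strict contraction. *)
Lemma finite_orbit_no_gap (X : choiceType) (act : gaction G X) (O : set X) :
  finite_set O -> O !=set0 -> (forall g x, O x -> O (act g x)) ->
  ~ spectral_gap R act.
Proof.
move=> finO [x0 Ox0] Oinv /spectral_gap_fs[s [s1 lt1]].
pose w : perm_rep R act := finite_restrict finO (fun=> 1).
have w_inv g : uact (perm_rep R act) g w = w.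
  apply/val_inj/funext => x /=; congr (if _ then _ else _).
  apply/idP/idP => /set_mem Ox; apply/mem_set; last exact: Oinv.
  by rewrite -(gactVK act g x); exact: Oinv.
have w0 : w != 0.
  apply/eqP => /(congr1 (fun f : ell2 R X => f x0))/eqP /=.
  by rewrite mem_set// oner_eq0.
have := @fs_act_opnorm _ _ (perm_rep R act) s w.
rewrite fs_act_invariant// s1 scale1r leNgt.
by rewrite gtr_pMl ?lt1 ?nrm_gt0.
Qed.

(** An invariant [v] is constant on orbits, and takes each nonzero value finitely
    often because it is square summable. *)
Lemma fixed_vector_orbit (X : choiceType) (act : gaction G X) (K : set G)
    (v : perm_rep R act) : v != 0 ->
  (forall g, K g -> uact (perm_rep R act) g v = v) ->
  exists2 x, (v : ell2 R X) x != 0 & finite_set [set act g x | g in K].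
Proof.
move=> v0 vK; have [x vx] : exists x, (v : ell2 R X) x != 0.
  apply: contrapT => h; move/eqP: v0; apply; apply/val_inj/funext => x /=.
  by apply/eqP/negPn/negP => vx; apply: h; exists x.
exists x => //.
have p0 : 0 < sqmod ((v : ell2 R X) x) by rewrite sqmod_cmod exprn_gt0// cmod_gt0.
have s0 y : 0 <= sqmod ((v : ell2 R X) y) by exact: sqmod_ge0.
apply: sub_finite_set (nnsum_finite_level p0 s0 (ell2P v)).
move=> _ [g Kg <-] /=; rewrite -{2}(vK _ Kg) /=.
by rewrite gactK.
Qed.

End PermutationRepresentations.

(** * Irreducibility from the spectral gap *)

Section Cosets.
Variable G : groupType.
Implicit Types (H L : groupClosed G) (g h x : G).

Lemma left_coset_mem H g : ltrans g [set` H] \in left_cosets H.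
Proof. by apply/mem_set; exists g. Qed.

Definition lcoset_of H g : left_cosets H := exist _ (ltrans g [set` H]) (left_coset_mem H g).

Lemma lcoset_of_surj H (A : left_cosets H) : exists g, A = lcoset_of H g.
Proof. by have /set_mem[g _ gA] := valP A; exists g; apply/val_inj; rewrite /= gA. Qed.

Lemma ltrans_eqP H g h : ltrans g [set` H] = ltrans h [set` H] <-> (g^-1 * h)%g \in H.
Proof.
split=> [gh|Hgh].
  have : ltrans h [set` H] h by exists 1%g; rewrite ?mulg1//=; exact: gpred1.
  by rewrite -gh => -[x /= Hx <-]; rewrite mulKg.
by rewrite -[h](mulVKg g) ltransM (ltransH Hgh).
Qed.

Lemma lcoset_of_eqP H g h : lcoset_of H g = lcoset_of H h <-> (g^-1 * h)%g \in H.
Proof.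
rewrite -ltrans_eqP; split=> [/(congr1 val)//|gh].
exact/val_inj.
Qed.

Lemma coset_actE H g h : coset_act_fun g (lcoset_of H h) = lcoset_of H (g * h)%g.
Proof. by apply/val_inj; rewrite /= ltransM. Qed.

Lemma lcoset_of_mem H h : h \in H -> lcoset_of H h = lcoset_of H 1%g.
Proof. by move=> Hh; apply/lcoset_of_eqP; rewrite mulg1 gpredV. Qed.

Definition nontrivial_incl H (A : nontrivial_left_cosets H) : left_cosets H.
Proof.
by exists (val A); apply/mem_set; have /set_mem[] := valP A.
Defined.

Lemma nontrivial_incl_inj H : injective (@nontrivial_incl H).
Proof. by move=> A B /(congr1 val) /= AB; exact/val_inj. Qed.

Lemma nontrivial_incl_range H (A : left_cosets H) :
  ~ range (@nontrivial_incl H) A -> A = lcoset_of H 1%g.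
Proof.
move=> nA; apply/val_inj; apply: contrapT => /= A1; apply: nA.
have memA : val A \in nontrivial_left_cosets H.
  apply/mem_set; split; first exact/set_mem/(valP A).
  by rewrite ltrans1 in A1.
by exists (exist _ (val A) memA) => //; exact/val_inj.
Qed.

End Cosets.

Section SpectralGap.
Variables (R : realType) (G : groupType) (H : groupClosed G).
Local Notation C := R[i].
Local Notation fsum := (seq (C * G)).
Local Notation p := (quasi_regular R H).
Local Notation o := (lcoset_of H 1%g).

Definition base_vec : p := point_mass R o.

(** On l^2(G/H) such an [s] fixes the point mass at the coset [H] and contracts its
    orthogonal complement, so the powers of [s] converge in norm to the rank-one
    projection onto that point mass. *)
Definition gap_element (s : fsum) (c : R) := [/\ {in s, forall u, u.2 \in H},
  fs_sum s = 1, 0 <= c < 1 &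
  forall f : p, (f : ell2 R _) o = 0 -> nrm (fs_act s f) <= c * nrm f].

(** Functions on G/H vanishing at [H] are functions on G/H minus the point [H],
    where the spectral gap of the action of [H] provides a strict contraction. *)
Lemma spectral_gap_element : spectral_gap_property R H ->
  exists s c, gap_element s c.
Proof.
move=> /spectral_gap_fs[s [s1 lt1]].
set q := perm_rep _ _ in lt1.
exists [seq (u.1, val u.2) | u <- s], (opnorm (@fs_act _ _ q s)); split.
- by move=> _ /mapP[u _ ->]; exact: (valP u.2).
- by rewrite /fs_sum big_map.
- by rewrite fs_opnorm_ge0.
move=> f f0; set t := [seq _ | _ <- _].
have inj := @nontrivial_incl_inj G H.
have off (h : p) : (h : ell2 R _) o = 0 -> nrm (pullback inj h) = nrm h.
  by move=> h0; apply: nrm_pullback => A /nontrivial_incl_range ->.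
rewrite -(off f f0) -off; last first.
  rewrite perm_fs_actE big1_seq// => u /andP[_ /mapP[w _ ->]] /=.
  by rewrite /= coset_actE mulg1 lcoset_of_mem ?f0 ?mulr0// gpredV; exact: (valP w.2).
have -> : pullback inj (fs_act t f) = fs_act s (pullback inj f : q).
  apply/val_inj/funext => A.
  rewrite -[LHS]/((fs_act t f : ell2 R _) (nontrivial_incl A)).
  rewrite -[RHS]/((fs_act s (pullback inj f : q) : ell2 R _) A) !perm_fs_actE big_map.
  apply: eq_bigr => u _ /=; congr (_ * (f : ell2 R _) _).
  exact/val_inj.
exact: (@fs_act_opnorm _ _ q s (pullback inj f)).
Qed.

Lemma base_vec_invariant h : h \in H -> uact p h base_vec = base_vec.
Proof.
move=> Hh; apply/val_inj/funext => A /=; congr (if _ then _ else _).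
rewrite !in_set1; apply/eqP/eqP => [|->]; last first.
  by rewrite /= coset_actE mulg1 lcoset_of_mem// gpredV.
have [g ->] := lcoset_of_surj A.
rewrite /= coset_actE => /lcoset_of_eqP.
by rewrite invgM invgK mulg1 gpredMr// => Hg; apply/lcoset_of_eqP; rewrite mulg1.
Qed.

Variables (s : fsum) (c : R) (gap : gap_element s c).

Lemma gap_base n : fs_act (fs_pow s n) base_vec = base_vec.
Proof.
have [sH s1 _ _] := gap; rewrite fs_act_pow; elim: n => //= n ->.
rewrite fs_act_invariant ?s1 ?scale1r// => u us.
by rewrite base_vec_invariant// sH.
Qed.

Lemma gap_pow_vanish n (f : p) : (f : ell2 R _) o = 0 ->
  nrm (fs_act (fs_pow s n) f) <= c ^+ n * nrm f.
Proof.
have [sH s1 /andP[c0 _] sc] := gap.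
move=> f0; rewrite fs_act_pow.
suff [] : (iter n (@fs_act _ _ p s) f : ell2 R _) o = 0 /\
  nrm (iter n (@fs_act _ _ p s) f) <= c ^+ n * nrm f by [].
elim: n => [|n [IH0 IHn]]; first by rewrite expr0 mul1r.
rewrite iterS; split; last first.
  by rewrite exprS -mulrA; apply: le_trans (sc _ IH0) _; rewrite ler_wpM2l.
rewrite perm_fs_actE big1_seq// => u /andP[_ us].
by rewrite /= coset_actE mulg1 lcoset_of_mem ?IH0 ?mulr0// gpredV sH.
Qed.

(** Only the part of [f] orthogonal to the base point is affected, and it decays
    geometrically: the powers of [s] converge in norm, at a rate that any weakly
    equivalent representation inherits. *)
Lemma gap_pow n (f : p) :
  nrm (fs_act (fs_pow s n) f - (f : ell2 R _) o *: base_vec) <= c ^+ n * nrm f.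
Proof.
set a := (f : ell2 R _) o.
have f'0 : (f - a *: base_vec : ell2 R _) o = 0.
  rewrite -[LHS]/(a - a * (point_mass R o : ell2 R _) o).
  by rewrite point_massE eqxx mulr1 subrr.
have -> : fs_act (fs_pow s n) f - a *: base_vec =
    fs_act (fs_pow s n) (f - a *: base_vec).
  by rewrite fs_actB fs_actZ gap_base.
apply: le_trans (gap_pow_vanish n f'0) _.
have [_ _ /andP[c0 _] _] := gap.
apply: ler_wpM2l; first exact: exprn_ge0.
apply: nrm_ell2_le; apply: nnsum_le => A.
rewrite -[(_ : ell2 R _) A]/((f : ell2 R _) A - a * (point_mass R o : ell2 R _) A).
rewrite point_massE; case: eqVneq => [->|_]; last by rewrite mulr0 subr0.
by rewrite mulr1 subrr /sqmod normr0 expr0n /= sqmod_ge0.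
Qed.

Lemma base_vec_neq0 : base_vec != 0.
Proof.
apply/eqP => /(congr1 (fun f : p => (f : ell2 R _) o))/eqP.
by rewrite point_massE eqxx oner_eq0.
Qed.

(** A closed invariant subspace is stable under the limit projection onto
    [base_vec]. Either it contains a function nonzero at the coset [H], hence
    [base_vec], all its translates, and everything by density; or all its elements
    vanish at [H], and by invariance at every coset. *)
Lemma gap_irreducible : irreducible p.
Proof.
split; first by exists base_vec; exact: base_vec_neq0.
move=> W Wcl W0 Wlin Wact.
have WZ a x : W x -> W (a *: x) by move=> Wx; rewrite -[_ *: _]addr0; exact: Wlin.
have WD x y : W x -> W y -> W (x + y) by move=> Wx Wy; rewrite -[x]scale1r; exact: Wlin.
have Wsum (I : Type) (r : seq I) (F : I -> p) : (forall i, W (F i)) -> W (\sum_(i <- r) F i).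
  by move=> WF; elim/big_ind : _ => //.
have Wfs t x : W x -> W (fs_act t x) by move=> Wx; apply: Wsum => u; exact/WZ/Wact.
have Wlim (u : nat -> p) (l : p) : (forall n, W (u n)) -> u @ \oo --> l -> W l.
  by move=> Wu; apply: closed_cvg => //; exists 0%N.
have [_ _ /andP[c0 c1] _] := gap.
have Wproj f : W f -> W ((f : ell2 R _) o *: base_vec).
  move=> Wf; apply: (Wlim (fun n => fs_act (fs_pow s n) f)) => [n|]; first exact: Wfs.
  apply/nrm_cvgP => e e0.
  have : (fun n => c ^+ n * nrm f) @ \oo --> 0 * nrm f.
    apply: cvgMl; apply: cvg_expr; by rewrite ger0_norm.
  rewrite mul0r => /cvgrPdist_le/(_ e e0)[N _ Ne]; exists N => n Nn.
  apply: le_trans (gap_pow n f) _; have := Ne n Nn.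
  by rewrite /= sub0r normrN ger0_norm// mulr_ge0 ?exprn_ge0 ?nrm_ge0.
have actE g f : (uact p g f : ell2 R _) o = (f : ell2 R _) (lcoset_of H g^-1%g).
  by rewrite /= coset_actE mulg1.
have [[f [Wf fo]]|nof] := pselect (exists f, W f /\ (f : ell2 R _) o != 0); last first.
  left; apply/seteqP; split=> [f Wf|_ -> //].
  apply/val_inj/funext => A; have [g ->] := lcoset_of_surj A.
  apply/eqP/negPn/negP => fg; apply: nof; exists (uact p g^-1%g f).
  by rewrite actE invgK; split=> //; exact: Wact.
right; apply/seteqP; split=> // h _.
have Wbase : W base_vec.
  rewrite -[base_vec]scale1r -(mulVf fo) -scalerA; exact/WZ/Wproj.
have Wpoint A : W (point_mass R A : p).
  have [g ->] := lcoset_of_surj A.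
  have -> // : point_mass R (lcoset_of H g) = uact p g base_vec :> p.
    apply/val_inj/funext => B.
    rewrite -[LHS]/((point_mass R (lcoset_of H g) : ell2 R _) B).
    rewrite -[RHS]/((point_mass R o : ell2 R _) (coset_act H g^-1%g B)) !point_massE.
    congr (if _ then _ else _); apply/eqP/eqP => [->|Bo].
      by rewrite /= coset_actE mulVg.
    by rewrite -(gactVK (coset_act H) g B) Bo /= coset_actE mulg1.
  exact: Wact.
have Wfin O (finO : finite_set O) f' : W (finite_restrict finO f' : p).
  by rewrite finite_restrict_sum; apply: Wsum => A; exact/WZ.
have /choice[u uh] (n : nat) : exists x : p, W x /\ nrm (x - h) <= n.+1%:R^-1.
  have [|O [finO hO]] := @finite_restrict_dense R _ h n.+1%:R^-1; first by rewrite invr_gt0.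
  by eexists; split; [exact: (Wfin O finO h)|exact: hO].
apply: (Wlim u) => [n|]; first by case: (uh n).
apply/nrm_cvgP => e e0; exists (Num.bound `|e^-1|) => n Nn.
have [_ /le_trans->//] := uh n.
rewrite -[e]invrK lef_pV2 ?posrE ?invr_gt0//; apply: le_trans (ler_norm _) _.
have := archi_boundP (normr_ge0 e^-1) => /ltW/le_trans->//.
by rewrite ler_nat leqW.
Qed.

End SpectralGap.

(** * Weak equivalence and commensurability *)

Section FixedVector.
Variables (R : realType) (G : groupType) (H : groupClosed G).
Local Notation p := (quasi_regular R H).

Lemma geometric_small (c e : R) : 0 <= c < 1 -> 0 < e ->
  exists N, forall n, (N <= n)%N -> c ^+ n <= e.
Proof.
move=> /andP[c0 c1] e0.
have : (fun n => c ^+ n) @ \oo --> (0 : R) by apply: cvg_expr; rewrite ger0_norm.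
move=> /cvgrPdist_le/(_ e e0)[N _ Ne]; exists N => n /Ne /=.
by rewrite sub0r normrN ger0_norm// exprn_ge0.
Qed.

(** Weak equivalence makes the norms of each element of C[G] in [p] and [q] equal.
    In [p] the powers of [s] form a Cauchy sequence of operators of norm at least 1,
    asymptotically fixed by left multiplication by every [h] in [H]; these three
    facts pass to [q], and the limit at a well-chosen vector is nonzero and
    invariant. *)
Lemma gap_fixed_vector (q : unirep R G) (s : seq (R[i] * G)) (c : R) :
  gap_element H s c -> weakly_equivalent q p ->
  exists2 v : q, v != 0 & forall h, h \in H -> uact q h v = v.
Proof.
move=> gap [qp pq]; have [_ _ c01 _] := gap.
have [c0 _] := andP c01.
pose P (r : unirep R G) n := @fs_act _ _ r (fs_pow s n).
have cn0 n : 0 <= c ^+ n by exact: exprn_ge0.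
(* Estimates on C[G] pass from [p] to [q] by weak containment of [q] in [p]. *)
have transfer t M x : 0 <= M -> (forall y : p, nrm (fs_act t y) <= M * nrm y) ->
    nrm (fs_act t x : q) <= M * nrm x.
  move=> M0 tM; apply: le_trans (@fs_act_opnorm _ _ q t x) _.
  apply: ler_wpM2r; first exact: nrm_ge0.
  exact: le_trans (weakly_contained_fs t qp) (opnorm_le_bound M0 tM).
have P_cauchy n m x : nrm (P q n x - P q m x) <= (c ^+ n + c ^+ m) * nrm x.
  pose t := fs_pow s n ++ fs_scale (-1) (fs_pow s m).
  have tE (r : unirep R G) y : fs_act t y = P r n y - P r m y.
    by rewrite fs_act_cat fs_act_scale scaleN1r.
  rewrite -tE; apply: transfer; first exact: addr_ge0.
  move=> y; rewrite tE; apply: le_trans (nrm_tri _ ((y : ell2 R _) (lcoset_of H 1%g) *: base_vec R H) _) _.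
  by rewrite mulrDl; apply: lerD; [|rewrite nrmBC]; exact: gap_pow.
have P_inv h n x : h \in H -> nrm (uact q h (P q n x) - P q n x) <= (c ^+ n + c ^+ n) * nrm x.
  move=> Hh; pose t := fs_mul [:: (1, h)] (fs_pow s n) ++ fs_scale (-1) (fs_pow s n).
  have tE (r : unirep R G) y : fs_act t y = uact r h (P r n y) - P r n y.
    by rewrite fs_act_cat fs_act_mul fs_act1 fs_act_scale scale1r scaleN1r.
  rewrite -tE; apply: transfer; first exact: addr_ge0.
  move=> y; rewrite tE; set b := (y : ell2 R _) (lcoset_of H 1%g) *: base_vec R H.
  have hb : uact p h b = b by rewrite /b linearZ /= base_vec_invariant.
  apply: le_trans (nrm_tri _ b _) _; rewrite mulrDl.
  apply: lerD; last by rewrite nrmBC; exact: gap_pow.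
  by rewrite -{1}hb -linearB nrm_uact; exact: gap_pow.
(* The reverse weak containment is what prevents the limit from being zero. *)
have P_big n : 1 <= opnorm (P q n).
  apply: le_trans (weakly_contained_fs (fs_pow s n) pq).
  have := @fs_act_opnorm _ _ p (fs_pow s n) (base_vec R H).
  by rewrite (gap_base gap) ler_pMl// nrm_gt0// base_vec_neq0.
(* At the rate 1/8, the later powers stay within 1/4 of the N-th one, whose value
   at [x] has norm above 1/2. *)
have [|N cN] := @geometric_small c (8^-1) c01; first by rewrite invr_gt0.
have [x [x1 xN]] : exists x : q, nrm x <= 1 /\ 2^-1 < nrm (P q N x).
  apply: contrapT => nox; have := P_big N; apply/negP; rewrite -ltNge.
  apply: (@le_lt_trans _ _ 2^-1); last by rewrite invf_lt1 ?ltr1n.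
  apply: opnorm_le => x x1; rewrite leNgt; apply/negP => xN; apply: nox.
  by exists x.
have small M : 0 <= M -> M * nrm x <= M by move=> M0; exact: ler_piMr.
have cv : cvg ((fun n => P q n x) @ \oo).
  apply: nrm_cauchy => e e0.
  have [|K Ke] := @geometric_small c (e / 2) c01; first by rewrite divr_gt0.
  exists K => n m Kn Km; apply: le_trans (P_cauchy _ _ _) _.
  apply: le_trans (small _ (addr_ge0 (cn0 n) (cn0 m))) _.
  by rewrite [leRHS]splitr lerD// Ke.
set v := lim ((fun n => P q n x) @ \oo) in cv.
have limP e : 0 < e -> exists K, forall n, (K <= n)%N -> nrm (P q n x - v) <= e.
  by move=> e0; have /nrm_cvgP/(_ e e0) := cv.
exists v => [|h Hh].
  apply/eqP => v0; have [|K Kv] := limP (8^-1); first by rewrite invr_gt0.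
  have := Kv (maxn K N) (leq_maxl _ _); rewrite v0 subr0 => Px.
  have := nrm_sub (P q N x) (P q (maxn K N) x).
  have := le_trans (P_cauchy N (maxn K N) x) (small _ (addr_ge0 (cn0 _) (cn0 _))).
  have := cN _ (leq_maxr K N); have := cN _ (leqnn N).
  move: xN Px; lra.
apply/eqP; rewrite -subr_eq0; apply/eqP/nrm_eq0/le_anti; rewrite nrm_ge0 andbT.
apply/ler_addgt0Pl => e e0; rewrite addr0.
have e4 : 0 < e / 4 by rewrite divr_gt0.
have [K Kv] := limP _ e4; have [M Mc] := @geometric_small c _ c01 e4.
set n := maxn K M.
have Pv := Kv n (leq_maxl _ _).
have := le_trans (P_inv h n x Hh) (small _ (addr_ge0 (cn0 _) (cn0 _))).
have := Mc n (leq_maxr _ _).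
have := nrm_tri (uact q h v) (uact q h (P q n x)) v.
have := nrm_tri (uact q h (P q n x)) (P q n x) v.
rewrite -(linearB (uact q h)) nrm_uact [nrm (v - _)]nrmBC.
move: Pv; lra.
Qed.

End FixedVector.

Section Commensurability.
Variable G : groupType.
Implicit Types H K L : groupClosed G.

(** For [g = 1] this says that the intersection of [H] and [L] has finite index in
    [H]; in general it says that the orbit of the coset [g L] under [H] is finite.
    Stated as a covering, the relation composes without any computation of indices. *)
Definition translate_covered H (g : G) L :=
  exists2 F : set G, finite_set F &
    forall h, h \in H -> exists2 f, F f & (f^-1 * (h * g))%g \in L.

Lemma finite_orbit_covered H L g :
  finite_set [set coset_act L h (lcoset_of L g) | h in [set` H]] ->
  translate_covered H g L.
Proof.
move=> fin; have /choice[r rE] := @lcoset_of_surj G L.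
exists (r @` [set coset_act L h (lcoset_of L g) | h in [set` H]]).
  exact: finite_image.
move=> h Hh; exists (r (coset_act L h (lcoset_of L g))).
  by exists (coset_act L h (lcoset_of L g)) => //; exists h.
by apply/lcoset_of_eqP; rewrite -rE /= coset_actE.
Qed.

Lemma translate_covered_trans H K L g k :
  translate_covered H g K -> translate_covered K k L ->
  translate_covered H (g * k)%g L.
Proof.
move=> [E finE HE] [F finF KF].
exists [set (e * f)%g | e in E & f in F].
  exact: finite_image2.
move=> h /HE[e Ee /KF[f Ff Lf]]; exists (e * f)%g; first by exists e => //; exists f.
by move: Lf; rewrite invgM !mulgA.
Qed.

Lemma translate_coveredMr H L g l : l \in L ->
  translate_covered H g L -> translate_covered H (g * l)%g L.
Proof.
move=> Ll [F finF HF]; exists F => // h /HF[f Ff Lf]; exists f => //.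
by rewrite !mulgA gpredMr//; move: Lf; rewrite mulgA.
Qed.

Variable R : realType.

(** If [x] is not in [H], the orbit of the coset [x H] under [H] lies in
    G/H minus the point [H]; being finite, it contradicts the spectral gap. In
    particular [H] is its own commensurator. *)
Lemma gap_self_covered H x : spectral_gap_property R H ->
  translate_covered H x H -> x \in H.
Proof.
move=> gap [F finF HF]; apply/negPn/negP => Hx; move: gap.
pose O := [set A : nontrivial_left_cosets H |
  exists2 h, h \in H & val A = ltrans (h * x)%g [set` H]].
apply: (@finite_orbit_no_gap _ _ _ _ O).
- apply: (@sub_finite_set _ _ (val @^-1` ((fun f => ltrans f [set` H]) @` F))).
    move=> A [h /HF[f Ff Hf] AE]; exists f => //; rewrite AE.
    exact/ltrans_eqP.
  apply: finite_preimage; last exact: finite_image.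
  by move=> A B _ _; exact: val_inj.
- have memx : ltrans x [set` H] \in nontrivial_left_cosets H.
    apply/mem_set; split; first by exists x.
    rewrite /= -[RHS]ltrans1 => /ltrans_eqP; rewrite mulg1 gpredV.
    exact/negP.
  exists (exist _ (ltrans x [set` H]) memx); exists 1%g; first exact: gpred1.
  by rewrite mul1g.
- move=> h A [k Hk AE]; exists (val h * k)%g.
    by rewrite gpredM//; exact: (valP h).
  by rewrite /= AE -ltransM mulgA.
Qed.

(** Composing the coverings gives [H (g k)] inside finitely many translates of [H],
    so [g k] is in [H] and [L g^-1] is covered by [H] as well. Therefore [H] and
    [g L g^-1] are commensurable, and both are self-commensurating. *)
Lemma covered_conjugate H L g k :
  spectral_gap_property R H -> spectral_gap_property R L ->
  translate_covered H g L -> translate_covered L k H ->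
  forall x, (x \in H) = ((x ^ g)%g \in L).
Proof.
move=> gapH gapL HgL LkH.
have Hgk : (g * k)%g \in H.
  exact/(gap_self_covered gapH)/(translate_covered_trans HgL).
have LVH : translate_covered L g^-1%g H.
  have -> : g^-1%g = (k * (g * k)^-1)%g by rewrite invgM mulgA mulgV mul1g.
  by apply: translate_coveredMr => //; rewrite gpredV.
move=> x; rewrite conjgE; apply/idP/idP => [Hx|Lx].
  apply: (gap_self_covered gapL); rewrite mulgA.
  exact: (translate_covered_trans (translate_coveredMr Hx LVH)).
have -> : x = (g * (g^-1 * (x * g)) * g^-1)%g by rewrite mulVKg mulgK.
apply: (gap_self_covered gapH).
exact: (translate_covered_trans (translate_coveredMr Lx HgL)).
Qed.

(** The [H]-invariant vector of l^2(G/L) given by weak equivalence has a finite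
    [H]-orbit in its support. *)
Lemma weakly_equivalent_covered H L : spectral_gap_property R H ->
  weakly_equivalent (quasi_regular R L) (quasi_regular R H) ->
  exists g, translate_covered H g L.
Proof.
move=> /spectral_gap_element[s [c gap]] /(gap_fixed_vector gap)[v v0 vH].
have [A _ fin] := @fixed_vector_orbit R G _ (coset_act L) [set` H] v v0 vH.
have [g gA] := lcoset_of_surj A; exists g.
by apply: finite_orbit_covered; rewrite -gA.
Qed.

(** Right multiplication by [g] maps [x K] to the coset [x g H], an equivariant
    bijection [psi] from G/K to G/H with inverse [phi]. The functions [r] and [t]
    choose representatives of cosets; [KHE] makes the choice immaterial. *)
Lemma conjugate_weakly_contained H K g : (forall x, (x \in K) = ((x ^ g)%g \in H)) ->
  weakly_contained (quasi_regular R K) (quasi_regular R H).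
Proof.
move=> KH.
have KHE x y : lcoset_of K x = lcoset_of K y <->
    lcoset_of H (x * g)%g = lcoset_of H (y * g)%g.
  by rewrite !lcoset_of_eqP KH conjgE invgM !mulgA.
have /choice[r rE] := @lcoset_of_surj G H.
have /choice[t tE] := @lcoset_of_surj G K.
pose phi (A : left_cosets H) := lcoset_of K (r A * g^-1)%g.
pose psi (B : left_cosets K) := lcoset_of H (t B * g)%g.
have phiE x : phi (lcoset_of H x) = lcoset_of K (x * g^-1)%g.
  by apply/KHE; rewrite !mulgVK -rE.
have psiE x : psi (lcoset_of K x) = lcoset_of H (x * g)%g.
  by apply/KHE; rewrite -tE.
apply: (@equivariant_weakly_contained _ _ _ _ _ _ phi).
  exists psi => A; first by rewrite (rE A) phiE psiE mulgVK.
  by rewrite (tE A) psiE phiE mulgK.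
by move=> x A; rewrite (rE A) /= coset_actE !phiE coset_actE mulgA.
Qed.

Lemma conjugate_weakly_equivalent H K g : (forall x, (x \in K) = ((x ^ g)%g \in H)) ->
  weakly_equivalent (quasi_regular R K) (quasi_regular R H).
Proof.
move=> KH; split; first exact: conjugate_weakly_contained KH.
apply: (@conjugate_weakly_contained K H g^-1%g) => x.
by rewrite KH -conjgM mulVg conjg1.
Qed.

Lemma weakly_equivalent_conjugate H L :
  spectral_gap_property R H -> spectral_gap_property R L ->
  weakly_equivalent (quasi_regular R L) (quasi_regular R H) ->
  exists g, forall x, (x \in H) = ((x ^ g)%g \in L).
Proof.
move=> gapH gapL LH.
have [g Hg] := weakly_equivalent_covered gapH LH.
have [k Lk] := weakly_equivalent_covered gapL (weakly_equivalent_sym LH).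
by exists g; exact: covered_conjugate Hg Lk.
Qed.

End Commensurability.

(** * The map on conjugacy classes *)

Section Classes.
Variables (R : realType) (G : groupType).

Lemma prim_class_eqP (p q : irrep R G) :
  prim_class p = prim_class q <-> weakly_equivalent p q.
Proof.
split=> [/(congr1 sval)/(congr1 (fun c => c p))/= E|pq].
  by rewrite -/(weak_class q p) -E; exact: weakly_equivalent_refl.
apply: eq_exist; apply/funext => r; apply/propext; split=> rp.
  exact: weakly_equivalent_trans pq.
exact: weakly_equivalent_trans (weakly_equivalent_sym pq).
Qed.

Lemma conj_quotient_eq (H K : Sub_sg R G) (g : G) :
  (forall x, (x \in sval K) = ((x ^ g)%g \in sval H)) ->
  conj_quotient K = conj_quotient H.
Proof.
move=> KH; apply: eq_exist; apply/funext => L; apply/propext; split=> -[h LK].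
  by exists (h * g)%g => x; rewrite LK KH conjgM.
by exists (h * g^-1)%g => x; rewrite LK KH -conjgM mulgVK.
Qed.

End Classes.

Theorem corollary4 (R : realType) (G : groupType)
    (G_countable : countable [set: G]) :
  exists Phi : Sub_sg R G -> Prim R G,
    (forall H : Sub_sg R G,
       exists irr : irreducible (quasi_regular R (sval H)),
         Phi H = prim_class (Irrep irr)) /\
    exists Psi : Sub_sg_conj R G -> Prim R G,
      (forall H : Sub_sg R G, Phi H = Psi (conj_quotient H)) /\
      injective Psi.
Proof.
have irr (H : Sub_sg R G) : irreducible (quasi_regular R (sval H)).
  by have [s [c gap]] := spectral_gap_element (svalP H); exact: gap_irreducible gap.
pose Phi H := prim_class (Irrep (irr H)).
have PhiE H K : conj_quotient H = conj_quotient K <-> Phi H = Phi K.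
  rewrite prim_class_eqP; split=> [/(congr1 sval)/= HK|/=].
    have [g gH] : conj_class K H.
      by rewrite -HK; exists 1%g => x; rewrite conjg1.
    exact: conjugate_weakly_equivalent gH.
  move=> /(weakly_equivalent_conjugate (svalP K) (svalP H))[g gK].
  exact/esym/(conj_quotient_eq gK).
exists Phi; split; first by move=> H; exists (irr H).
have /choice[rep repE] (c : Sub_sg_conj R G) : exists H, c = conj_quotient H.
  by case: c => c [H cH]; exists H; exact: eq_exist.
exists (Phi \o rep); split=> [H|c d /PhiE]; first by apply/PhiE; rewrite -repE.
by rewrite -!repE.
Qed.
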